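(* Let $\mathrm{d}\Pi_0$, $\mathrm{d}E$, $\mathrm{d}R$ be (signed) Lebesgue–Stieltjes measures supported on $[1,\infty)$ and put $\mathrm{d}\Pi=\mathrm{d}\Pi_0+\mathrm{d}E+\mathrm{d}R$. Assume: (i) there is $a>0$ such that $M_0(x):=\int_{1^-}^{x}\exp^{\ast}(-\mathrm{d}\Pi_0)=O\!\left(\frac{x}{\log^{a}x}\right)$ as $x\to\infty$; (ii) $\int_{1^-}^{x}|\mathrm{d}E(u)|=o\!\left(\frac{x}{\log x}\right)$ as $x\to\infty$; (iii) $\int_{1^-}^{\infty}\frac{|\mathrm{d}R(u)|}{u}<\infty$. Then $M(x):=\int_{1^-}^{x}\exp^{\ast}(-\mathrm{d}\Pi)=o(x)$ as $x\to\infty$.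
   Context: All measures are locally finite signed Borel measures on $[1,\infty)$; their primitives are right-continuous and supported on $[1,\infty)$. The notation $\int_{1^-}^{x}$ means integration over $[1,x]$. $|\mathrm{d}A|$ denotes the total variation measure of $\mathrm{d}A$. The (multiplicative) convolution of measures is defined by $\int_{1^-}^{x}\mathrm{d}A\ast\mathrm{d}B=\iint_{1\le uv\le x}\mathrm{d}A(u)\,\mathrm{d}B(v)$, and $\exp^{\ast}(\mathrm{d}A)=\sum_{n=0}^{\infty}\frac{1}{n!}\mathrm{d}A^{\ast n}$, where $\mathrm{d}A^{\ast 0}=\delta_1$ is the Dirac measure at $1$. *)

(* Defs.v *)
From HB Require Import structures.
From mathcomp Require Import all_boot all_order all_algebra.
From mathcomp Require Import all_classical all_reals all_analysis.
From mathcomp Require Import measurable_realfun charge.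

Set Implicit Arguments.
Unset Strict Implicit.
Unset Printing Implicit Defensive.

Import Order.TTheory GRing.Theory Num.Theory.
Import numFieldNormedType.Exports.

Local Open Scope classical_set_scope.
Local Open Scope ring_scope.
Local Open Scope ereal_scope.

(* Lets the Landau notations of the library be used at +oo. *)
Canonical pinfty_filter_on (R : numFieldType) :=
  FilterType (pinfty_nbhs R) _.

(* Positive locally finite measures on [1, +oo[, as Borel measures on R giving
   mass 0 to ]-oo, 1[. *)
Record lfmeasure (R : realType) := LFMeasure {
  lfm :> {measure set R -> \bar R} ;
  lfm_fin : forall x : R, lfm `[1%R, x]%classic < +oo ;
  lfm_supp : lfm `]-oo, 1%R[%classic = 0 }.

Section lfmeasure_theory.
Context {R : realType}.
Implicit Types m : lfmeasure R.

Lemma lfm_ray_fin m (x : R) : m `]-oo, x]%classic < +oo.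
Proof.
apply: (@le_lt_trans _ _ (m (`]-oo, 1%R[%classic `|` `[1%R, x]%classic))).
  apply: le_measure; rewrite ?inE//=; first exact: measurableU.
  move=> y /=; rewrite !in_itv/= => yx.
  by case: (ltP y 1%R) => y1; [left|right]; rewrite /= ?in_itv/= ?y1 ?yx.
apply: (le_lt_trans (measureU2 _ _ _)) => //=.
by rewrite lfm_supp add0e; exact: lfm_fin.
Qed.

Lemma lfm_sigma_finite m : sigma_finite setT m.
Proof.
exists (fun n : nat => `]-oo, n%:R : R]%classic).
  apply/esym/seteqP; split=> // x _.
  exists (Num.bound `|x|%R) => //=; rewrite in_itv/=.
  exact: le_trans (ler_norm x) (ltW (archi_boundP (normr_ge0 x))).
by move=> n; split => //; exact: lfm_ray_fin.
Qed.

Definition lfm_sf m : set R -> \bar R := m.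

HB.instance Definition _ m := Measure.on (lfm_sf m).
HB.instance Definition _ m :=
  Measure_isSigmaFinite.Build _ _ _ (lfm_sf m) (lfm_sigma_finite m).

Lemma lfm0_fin (x : R) : (@mzero _ R R) `[1%R, x]%classic < +oo.
Proof. exact: ltry. Qed.

Lemma lfm0_supp : (@mzero _ R R) `]-oo, 1%R[%classic = 0.
Proof. by []. Qed.

Definition lfm0 : lfmeasure R := LFMeasure lfm0_fin lfm0_supp.

Lemma lfm_dirac1_fin (x : R) : (@dirac _ R 1%R R) `[1%R, x]%classic < +oo.
Proof. by rewrite diracE ltry. Qed.

Lemma lfm_dirac1_supp : (@dirac _ R 1%R R) `]-oo, 1%R[%classic = 0.
Proof. by rewrite diracE memNset//= in_itv/= ltxx. Qed.

Definition lfm_dirac1 : lfmeasure R := LFMeasure lfm_dirac1_fin lfm_dirac1_supp.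

Lemma lfm_add_fin m1 m2 (x : R) : measure_add m1 m2 `[1%R, x]%classic < +oo.
Proof. by rewrite measure_addE lte_add_pinfty//; exact: lfm_fin. Qed.

Lemma lfm_add_supp m1 m2 : measure_add m1 m2 `]-oo, 1%R[%classic = 0.
Proof. by rewrite measure_addE !lfm_supp adde0. Qed.

Definition lfm_add m1 m2 : lfmeasure R :=
  LFMeasure (lfm_add_fin m1 m2) (lfm_add_supp m1 m2).

Lemma lfm_addE m1 m2 (X : set R) : lfm_add m1 m2 X = m1 X + m2 X.
Proof. exact: measure_addE. Qed.

(* The convolution is the image of the product measure under (u, v) |-> uv. *)
Definition mulRR (z : R * R) : R := (z.1 * z.2)%R.

Lemma measurable_mulRR : measurable_fun setT mulRR.
Proof. by apply: measurable_funM; [exact: measurable_fst|exact: measurable_snd]. Qed.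

Definition mconv m1 m2 : set R -> \bar R :=
  pushforward (m1 \x lfm_sf m2) mulRR.

Let mconv0 m1 m2 : mconv m1 m2 set0 = 0.
Proof. by rewrite /mconv /pushforward preimage_set0 measure0. Qed.

Let mconv_ge0 m1 m2 B : 0 <= mconv m1 m2 B.
Proof. by rewrite /mconv /pushforward measure_ge0. Qed.

Let mconv_sigma_additive m1 m2 : semi_sigma_additive (mconv m1 m2).
Proof.
exact: (@measure_semi_sigma_additive _ _ _
  (measure_function_pushforward__canonical__measure_function_Measure
    (m1 \x lfm_sf m2) measurable_mulRR)).
Qed.

HB.instance Definition _ m1 m2 := isMeasure.Build _ _ _ (mconv m1 m2)
  (mconv0 m1 m2) (@mconv_ge0 m1 m2) (@mconv_sigma_additive m1 m2).

Lemma mconv_null m1 m2 :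
  (m1 \x lfm_sf m2) (`]-oo, 1%R[ `*` setT `|` setT `*` `]-oo, 1%R[) = 0.
Proof.
have p1 : measurable (`]-oo, 1%R[ `*` [set: R] : set (R * R)) by exact: measurableX.
have p2 : measurable ([set: R] `*` `]-oo, 1%R[ : set (R * R)) by exact: measurableX.
apply/eqP; rewrite eq_le measure_ge0 andbT.
apply: (le_trans (measureU2 _ p1 p2)).
by rewrite /= !product_measure1E//= {1}/lfm_sf !lfm_supp mul0e mule0 adde0.
Qed.

Lemma mconv_le m1 m2 (x : R) :
  mconv m1 m2 `[1%R, x]%classic <= m1 `[1%R, x]%classic * m2 `[1%R, x]%classic.
Proof.
have p1 : measurable (`]-oo, 1%R[ `*` [set: R] : set (R * R)) by exact: measurableX.
have p2 : measurable ([set: R] `*` `]-oo, 1%R[ : set (R * R)) by exact: measurableX.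
have p3 : measurable (`[1%R, x] `*` `[1%R, x] : set (R * R)) by exact: measurableX.
have mf := measurable_mulRR measurableT (measurable_itv `[1%R, x]).
rewrite setTI in mf.
rewrite /mconv /pushforward.
apply: (@le_trans _ _ ((m1 \x lfm_sf m2) ((`[1%R, x] `*` `[1%R, x]) `|`
   (`]-oo, 1%R[ `*` setT `|` setT `*` `]-oo, 1%R[)))).
  apply: le_measure; rewrite ?inE//; first by do 2?apply: measurableU.
  move=> -[u v]; rewrite /mulRR/= in_itv/= => /andP[uv1 uvx].
  have [u1|u1] := ltP u 1%R; first by right; left; rewrite /= in_itv.
  have [v1|v1] := ltP v 1%R; first by right; right; rewrite /= in_itv.
  left; rewrite /= !in_itv/= u1 v1/=; split; apply: le_trans uvx.
    by rewrite ler_peMr// (le_trans _ u1).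
  by rewrite ler_peMl// (le_trans _ v1).
apply: (le_trans (measureU2 _ p3 (measurableU _ _ p1 p2))) => /=.
by rewrite mconv_null adde0 product_measure1E.
Qed.

Lemma mconv_fin m1 m2 (x : R) : mconv m1 m2 `[1%R, x]%classic < +oo.
Proof.
apply: (le_lt_trans (mconv_le m1 m2 x)).
by rewrite lte_mul_pinfty ?lfm_fin// ge0_fin_numE// lfm_fin.
Qed.

Lemma mconv_supp m1 m2 : mconv m1 m2 `]-oo, 1%R[%classic = 0.
Proof.
have p1 : measurable (`]-oo, 1%R[ `*` [set: R] : set (R * R)) by exact: measurableX.
have p2 : measurable ([set: R] `*` `]-oo, 1%R[ : set (R * R)) by exact: measurableX.
have mf := measurable_mulRR measurableT (measurable_itv `]-oo, 1%R[).
rewrite setTI in mf.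
apply/eqP; rewrite eq_le measure_ge0 andbT -(mconv_null m1 m2) /mconv /pushforward.
apply: le_measure; rewrite ?inE//; first exact: measurableU.
move=> -[u v]; rewrite /mulRR/= !in_itv/= => uv1.
have [u1|u1] := ltP u 1%R; first by left.
have [v1|v1] := ltP v 1%R; first by right.
by move: uv1; rewrite ltNge mulr_ege1.
Qed.

Definition lfm_conv m1 m2 : lfmeasure R :=
  LFMeasure (mconv_fin m1 m2) (mconv_supp m1 m2).

End lfmeasure_theory.

(* A locally finite signed measure on [1, +oo[ is a difference of two positive
   ones. The decomposition need not be the Jordan one. The value signed_val is
   meaningful on bounded Borel sets only: elsewhere it could be +oo - +oo. *)
Record smeasure (R : realType) := SMeasure {
  spos : lfmeasure R ;
  sneg : lfmeasure R }.

Section smeasure_theory.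
Context {R : realType}.
Implicit Types A B : smeasure R.

Definition signed_val A (X : set R) : R := (fine (spos A X) - fine (sneg A X))%R.

(* int_(1-)^x dA *)
Definition primitive A (x : R) : R := signed_val A `[1%R, x]%classic.

Definition sadd A B : smeasure R :=
  SMeasure (lfm_add (spos A) (spos B)) (lfm_add (sneg A) (sneg B)).

Definition sopp A : smeasure R := SMeasure (sneg A) (spos A).

Definition sdirac1 : smeasure R := SMeasure lfm_dirac1 lfm0.

Definition sconv A B : smeasure R :=
  SMeasure
    (lfm_add (lfm_conv (spos A) (spos B)) (lfm_conv (sneg A) (sneg B)))
    (lfm_add (lfm_conv (spos A) (sneg B)) (lfm_conv (sneg A) (spos B))).

Fixpoint sconvn A (n : nat) : smeasure R :=
  if n is k.+1 then sconv A (sconvn A k) else sdirac1.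

Lemma sconvn_le A (x r : R) : spos A `[1%R, x]%classic + sneg A `[1%R, x]%classic <= r%:E ->
  forall n, spos (sconvn A n) `[1%R, x]%classic + sneg (sconvn A n) `[1%R, x]%classic
            <= (r ^+ n)%:E.
Proof.
move=> Ar; elim => [|n IH].
  by rewrite expr0 /= diracE /mzero adde0 lee_fin; case: (_ \in _).
rewrite exprS EFinM; apply: (@le_trans _ _ (
  (spos A `[1%R, x]%classic + sneg A `[1%R, x]%classic) *
  (spos (sconvn A n) `[1%R, x]%classic + sneg (sconvn A n) `[1%R, x]%classic))); last first.
  by apply: lee_pmul => //; exact: adde_ge0.
rewrite [sconvn A n.+1]/= [spos (sconv _ _)]/= [sneg (sconv _ _)]/= !lfm_addE.
rewrite ge0_muleDl// !ge0_muleDr//.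
rewrite [X in _ <= _ + X]addeC [leRHS]addeACA.
by apply: leeD; apply: leeD; exact: mconv_le.
Qed.

Definition mexp (p : nat -> lfmeasure R) : set R -> \bar R :=
  mseries (fun n => mscale (n`!%:R^-1)%:nng%R (p n)) 0.

HB.instance Definition _ p := Measure.on (mexp p).

Lemma mexp_fin (p : nat -> lfmeasure R) (x r : R) : (0 <= r)%R ->
  (forall n, p n `[1%R, x]%classic <= (r ^+ n)%:E) ->
  mexp p `[1%R, x]%classic < +oo.
Proof.
move=> r0 pr; apply: (@le_lt_trans _ _ (\sum_(0 <= n <oo) (exp_coeff r n)%:E)).
  apply: lee_nneseries => [n _ _|n _]; first exact: measure_ge0.
  rewrite /exp_coeff/= /mscale mulrC EFinM.
  by rewrite lee_wpmul2l ?lee_fin// pr.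
rewrite (_ : \sum_(0 <= n <oo) _ = (expR r)%:E) ?ltry//.
apply/cvg_lim => //; under eq_fun do rewrite sumEFin.
apply: cvg_EFin; first by near=> n.
exact: is_cvg_series_exp_coeff.
Unshelve. all: by end_near. Qed.

Lemma mexp_supp (p : nat -> lfmeasure R) : mexp p `]-oo, 1%R[%classic = 0.
Proof.
by rewrite /mexp /mseries eseries0// => n _ _; rewrite /= /mscale lfm_supp mule0.
Qed.

Lemma sexp_pos_fin A (x : R) :
  mexp (fun n => spos (sconvn A n)) `[1%R, x]%classic < +oo.
Proof.
have fA : spos A `[1%R, x]%classic + sneg A `[1%R, x]%classic \is a fin_num.
  by rewrite ge0_fin_numE ?adde_ge0// lte_add_pinfty//; exact: lfm_fin.
apply: (@mexp_fin _ _ (fine (spos A `[1%R, x]%classic + sneg A `[1%R, x]%classic))).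
  by rewrite fine_ge0// adde_ge0.
move=> n; apply: le_trans (@sconvn_le A x _ _ n); last by rewrite fineK.
by rewrite leeDl.
Qed.

Lemma sexp_neg_fin A (x : R) :
  mexp (fun n => sneg (sconvn A n)) `[1%R, x]%classic < +oo.
Proof.
have fA : spos A `[1%R, x]%classic + sneg A `[1%R, x]%classic \is a fin_num.
  by rewrite ge0_fin_numE ?adde_ge0// lte_add_pinfty//; exact: lfm_fin.
apply: (@mexp_fin _ _ (fine (spos A `[1%R, x]%classic + sneg A `[1%R, x]%classic))).
  by rewrite fine_ge0// adde_ge0.
move=> n; apply: le_trans (@sconvn_le A x _ _ n); last by rewrite fineK.
by rewrite leeDr.
Qed.

Definition sexp A : smeasure R :=
  SMeasure (LFMeasure (sexp_pos_fin A) (mexp_supp _))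
           (LFMeasure (sexp_neg_fin A) (mexp_supp _)).

Definition piece (n : nat) : set R := `[n%:R, n.+1%:R[%classic.

Lemma measurable_piece n : measurable (piece n).
Proof. exact: measurable_itv. Qed.

Definition lfm_piece (m : lfmeasure R) (n : nat) : set R -> \bar R :=
  mrestr m (measurable_piece n).

HB.instance Definition _ m n := Measure.on (lfm_piece m n).

Lemma lfm_piece_fin m n : fin_num_fun (lfm_piece m n).
Proof.
move=> X mX; rewrite ge0_fin_numE ?measure_ge0// /lfm_piece /mrestr.
apply: le_lt_trans (lfm_ray_fin m n.+1%:R).
apply: le_measure; rewrite ?inE//; first by apply: measurableI => //; exact: measurable_piece.
by move=> y [_]; rewrite /piece /= !in_itv/= => /andP[_ /ltW].
Qed.

HB.instance Definition _ m n :=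
  Measure_isFinite.Build _ _ _ (lfm_piece m n) (lfm_piece_fin m n).

Definition spiece A (n : nat) : {charge set R -> \bar R} :=
  cadd (charge_of_finite_measure (lfm_piece (spos A) n))
       (copp (charge_of_finite_measure (lfm_piece (sneg A) n))).

Definition charge_var (nu : {charge set R -> \bar R}) :
    {measure set R -> \bar R} :=
  charge_variation (projT2 (cid (projT2 (cid (Hahn_decomposition nu))))).

(* The total variation measure |dA|. A charge in the library is finite, so the
   variations of the restrictions of dA to the intervals [n, n + 1[ are summed. *)
Definition mvar A : set R -> \bar R := mseries (fun n => charge_var (spiece A n)) 0.

HB.instance Definition _ A := Measure.on (mvar A).

Lemma spieceE A n (X : set R) : measurable X ->
  spiece A n X = (signed_val A (X `&` piece n))%:E.
Proof.
move=> mX.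
have fin m : (m : lfmeasure R) (X `&` piece n) \is a fin_num.
  exact: (@lfm_piece_fin m n _ mX).
by rewrite /signed_val EFinB !fineK.
Qed.

Lemma charge_var_abs (nu : {charge set R -> \bar R}) (X : set R) :
  measurable X -> `|nu X| <= charge_var nu X.
Proof. exact: abse_charge_variation. Qed.

Lemma charge_variation_le (nu : {charge set R -> \bar R}) (P N : set R)
    (nuPN : hahn_decomposition nu P N) (mu : {measure set R -> \bar R}) :
  (forall X, measurable X -> `|nu X| <= mu X) ->
  forall X, measurable X -> charge_variation nuPN X <= mu X.
Proof.
move=> numu X mX; have [[mP _] [mN _] PNT PN0] := nuPN.
rewrite /charge_variation /= jordan_posE jordan_negE cjordan_posE cjordan_negE.
rewrite /crestr0 mem_set// /crestr.
rewrite -[X in _ <= mu X]setIT -PNT setIUr measureU//; last 3 first.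
- exact: measurableI.
- exact: measurableI.
- by rewrite setIACA setIid PN0 setI0.
apply: leeD.
  by apply: le_trans (numu _ (measurableI _ _ mX mP)); exact: lee_abs.
apply: le_trans (numu _ (measurableI _ _ mX mN)).
by rewrite -abseN; exact: lee_abs.
Qed.

Lemma charge_var_le (nu : {charge set R -> \bar R})
    (mu : {measure set R -> \bar R}) :
  (forall X, measurable X -> `|nu X| <= mu X) ->
  forall X, measurable X -> charge_var nu X <= mu X.
Proof. exact: charge_variation_le. Qed.

Lemma measure_pieces (mu : {measure set R -> \bar R}) (X : set R) :
  measurable X ->
  \sum_(0 <= n <oo) mu (X `&` piece n) = mu (X `&` `[0%R, +oo[).
Proof.
move=> mX.
have -> : X `&` `[0%R, +oo[ = \bigcup_n (X `&` piece n).
  rewrite -setI_bigcupr; congr (_ `&` _); apply/seteqP; split => y /=.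
    rewrite in_itv/= andbT => y0; exists (Num.trunc y) => //.
    by rewrite /piece/= in_itv/=; exact: trunc_itv.
  by move=> [n _]; rewrite /piece/= !in_itv/= andbT => /andP[+ _]; exact: le_trans.
apply/cvg_lim => //; apply: measure_semi_sigma_additive.
- by move=> n; apply: measurableI => //; exact: measurable_piece.
- apply: trivIset_setIl; apply/trivIsetP => i j _ _ ij.
  apply/seteqP; split => // y [].
  rewrite /piece/= !in_itv/= => /andP[iy yi] /andP[jy yj].
  move: ij; rewrite neq_ltn => /orP[ij|ij].
    have h : (i.+1%:R <= j%:R :> R)%R by rewrite ler_nat.
    by have := lt_le_trans yi (le_trans h jy); rewrite ltxx.
  have h : (j.+1%:R <= i%:R :> R)%R by rewrite ler_nat.
  by have := lt_le_trans yj (le_trans h iy); rewrite ltxx.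
- by apply: bigcup_measurable => n _; apply: measurableI => //; exact: measurable_piece.
Qed.

Lemma lfm_pieces (m : lfmeasure R) (X : set R) : measurable X ->
  m X = \sum_(0 <= n <oo) lfm_piece m n X.
Proof.
move=> mX; rewrite [RHS](measure_pieces m mX).
rewrite -[in LHS](setIT X) -(setUv `[0%R, +oo[) setIUr measureU//; last 3 first.
- exact: measurableI.
- by apply: measurableI => //; exact: measurableC.
- by rewrite setIACA setICr setI0.
rewrite [X in _ + X](_ : _ = 0) ?adde0//.
apply/eqP; rewrite eq_le measure_ge0 andbT -(lfm_supp m).
apply: le_measure; rewrite ?inE//.
  by apply: measurableI => //; exact: measurableC.
move=> y [_]/=; rewrite !in_itv/= andbT => /negP; rewrite -ltNge => y0.
exact: lt_trans ltr01.
Qed.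

(* Together with mvar_abs: mvar A is the least measure that bounds |A(X)| for
   every bounded Borel set X. *)
Lemma mvar_le A (mu : {measure set R -> \bar R}) :
  (forall (X : set R) (x : R), measurable X -> X `<=` `]-oo, x] ->
    `|signed_val A X|%:E <= mu X) ->
  forall X, measurable X -> mvar A X <= mu X.
Proof.
move=> Amu X mX; apply: (@le_trans _ _ (mu (X `&` `[0%R, +oo[))); last first.
  apply: le_measure; rewrite ?inE//; first exact: measurableI.
rewrite -measure_pieces//; apply: lee_nneseries => [n _ _|n _].
  exact: measure_ge0.
apply: (@charge_var_le _ (mrestr mu (measurable_piece n))) => // Y mY.
rewrite spieceE// abse_EFin; apply: (Amu _ n.+1%:R).
  by apply: measurableI => //; exact: measurable_piece.
by move=> y [_]; rewrite /piece /= !in_itv/= => /andP[_ /ltW].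
Qed.

Lemma mvar_le_add A (X : set R) : measurable X -> mvar A X <= spos A X + sneg A X.
Proof.
move=> mX; rewrite -lfm_addE; apply: mvar_le => // Y x mY Yx.
have fin m : (m : lfmeasure R) Y \is a fin_num.
  rewrite ge0_fin_numE//; apply: le_lt_trans (lfm_ray_fin m x).
  by apply: le_measure; rewrite ?inE.
rewrite lfm_addE -[spos A Y]fineK ?fin// -[sneg A Y]fineK ?fin//.
rewrite -EFinD lee_fin; apply: le_trans (ler_normB _ _) _.
by rewrite !ger0_norm ?fine_ge0.
Qed.

Lemma mvar_abs A (X : set R) (x : R) : measurable X -> X `<=` `]-oo, x] ->
  `|signed_val A X|%:E <= mvar A X.
Proof.
move=> mX Xx.
have fin m : (m : lfmeasure R) X \is a fin_num.
  rewrite ge0_fin_numE//; apply: le_lt_trans (lfm_ray_fin m x).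
  by apply: le_measure; rewrite ?inE.
have key n : `|lfm_piece (spos A) n X - lfm_piece (sneg A) n X|
    <= charge_var (spiece A n) X by exact: charge_var_abs.
have fp m n : lfm_piece m n X \is a fin_num by exact: lfm_piece_fin.
have le1 : spos A X <= mvar A X + sneg A X.
  rewrite (lfm_pieces _ mX) [X in _ + X](lfm_pieces _ mX) -nneseriesD//.
  apply: lee_nneseries => // n _.
  by rewrite -leeBlDr//; apply: le_trans (key n); exact: lee_abs.
have le2 : sneg A X <= mvar A X + spos A X.
  rewrite (lfm_pieces _ mX) [X in _ + X](lfm_pieces _ mX) -nneseriesD//.
  apply: lee_nneseries => // n _.
  rewrite -leeBlDr//; apply: le_trans (key n).
  by rewrite -abseN fin_num_oppeB// addeC; exact: lee_abs.
have fv : mvar A X \is a fin_num.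
  rewrite ge0_fin_numE; last exact: measure_ge0.
  apply: (le_lt_trans (mvar_le_add _ _)) => //.
  by rewrite lte_add_pinfty// -ge0_fin_numE.
move: le1 le2; rewrite /signed_val -(fineK (fin (spos A))) -(fineK (fin (sneg A))).
rewrite -(fineK fv) -!EFinD !lee_fin /= => le1 le2.
by rewrite ler_norml lerNl opprB !lerBlDr le1 le2.
Qed.

Lemma svar_fin A (x : R) : mvar A `[1%R, x]%classic < +oo.
Proof.
apply: (le_lt_trans (mvar_le_add _ _)) => //.
by rewrite lte_add_pinfty//; exact: lfm_fin.
Qed.

Lemma svar_supp A : mvar A `]-oo, 1%R[%classic = 0.
Proof.
apply/eqP; rewrite eq_le measure_ge0 andbT.
by apply: (le_trans (mvar_le_add _ _)) => //; rewrite !lfm_supp adde0.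
Qed.

Definition svar A : lfmeasure R := LFMeasure (svar_fin A) (svar_supp A).

End smeasure_theory.

(* Main.v *)
(** A measure m on [1, oo[ acts on functions by (T_m g)(x) = int g(x u) dm(u). Encoding a
    signed measure as a pair of positive ones, and letting it act on functions of a sign
    and a point, every sum and integral is nonnegative; Tonelli then gives
    exp*(dA + dB) = exp*(dA) * exp*(dB) for pairs, without convergence issues. Adding the
    same measure to both components of A does not change the primitive of exp*(A), so
    that E and R may be replaced by their Jordan decompositions.

    Hence |M(x)| <= int int |M_0(x / (u v))| dF(u) dG(v) with F = exp*(|dE|) and
    G = exp*(|dR|). As int dG(v) / v <= exp (int |dR(v)| / v) is finite, it suffices to
    show that J(y) = int b(y / u) dF(u) / u tends to 0, where b(z) = |M_0(z)| / z is
    O(log^-a z). Write t = log y and H(y) = int_[1, y] dF(u) / u. First,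
    H(y) <= exp (int_[1, y] |dE(u)| / u) = O(t^d) for every d > 0. Next,
    log . dF = (log . |dE|) * dF gives
      t J(y) <= int dF(v) / v int (log u / u) b(y / (u v)) |dE(u)| + O(t^(1 - a) H(y)),
    and the inner integral is O(t^(1 - a/2)): bound b by a constant for u within a factor
    exp (sqrt t) of y / v, and by O(t^(-a/2)) otherwise. So J(y) = O(t^(-a/4)). *)

Require Import Defs.
From HB Require Import structures.
From mathcomp Require Import all_boot all_order all_algebra.
From mathcomp Require Import all_classical all_reals all_analysis.
From mathcomp Require Import measurable_realfun charge ring lra.

Set Implicit Arguments.
Unset Strict Implicit.
Unset Printing Implicit Defensive.

Import Order.TTheory GRing.Theory Num.Theory.
Import numFieldNormedType.Exports.

Local Open Scope classical_set_scope.
Local Open Scope ring_scope.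

(** * Dilation operators of positive measures: linearity, Tonelli, convolution *)

Section dilation_operators.
Local Open Scope ereal_scope.
Context {R : realType}.
Implicit Types (m : lfmeasure R) (A B : smeasure R) (g h : R -> \bar R).

Definition nnm g := measurable_fun [set: R] g /\ forall x, 0 <= g x.

Definition dil m g (x : R) : \bar R := \int[lfm_sf m]_u g (x * u)%R.

Lemma nnm_mulr g (x : R) : nnm g -> nnm (fun u => g (x * u)%R).
Proof.
move=> [mg g0]; split=> //; exact: measurableT_comp.
Qed.

Lemma nnm_mulRR g : nnm g -> measurable_fun [set: R * R] (fun z => g (z.1 * z.2)%R).
Proof.
move=> [mg g0]; exact: (measurableT_comp mg measurable_mulRR).
Qed.

Lemma nnmD g h : nnm g -> nnm h -> nnm (fun x => g x + h x).
Proof.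
move=> [mg g0] [mh h0]; split; first exact: emeasurable_funD.
by move=> x; exact: adde_ge0.
Qed.

Lemma nnmM g h : nnm g -> nnm h -> nnm (fun x => g x * h x).
Proof.
move=> [mg g0] [mh h0]; split; first exact: emeasurable_funM.
by move=> x; exact: mule_ge0.
Qed.

Lemma nnm_cst (k : \bar R) : 0 <= k -> nnm (cst k).
Proof. by move=> k0; split => //; exact: measurable_cst. Qed.

Lemma nnmZ (k : \bar R) g : 0 <= k -> nnm g -> nnm (fun x => k * g x).
Proof. by move=> /nnm_cst; exact: nnmM. Qed.

Lemma nnm_nneseries (h : nat -> R -> \bar R) : (forall n, nnm (h n)) ->
  nnm (fun x => \sum_(0 <= n <oo) h n x).
Proof.
move=> hh; split.
  by apply: ge0_emeasurable_sum => [k x _ _|k _]; case: (hh k).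
by move=> x; apply: nneseries_ge0 => n _ _; case: (hh n).
Qed.

Lemma nnm_dil m g : nnm g -> nnm (dil m g).
Proof.
move=> ng; split; last by move=> x; apply: integral_ge0 => u _; case: ng.
apply: (measurable_fun_fubini_tonelli_F (fun z : R * R => g (z.1 * z.2)%R)).
- exact: nnm_mulRR.
- by move=> z; case: ng.
Qed.

Lemma dil_ge0 m g x : nnm g -> 0 <= dil m g x.
Proof. by case/(nnm_dil m). Qed.

Lemma dilD m g h x : nnm g -> nnm h ->
  dil m (fun y => g y + h y) x = dil m g x + dil m h x.
Proof.
move=> /(nnm_mulr x)[mg g0] /(nnm_mulr x)[mh h0].
by rewrite /dil ge0_integralD.
Qed.

Lemma dilZ m (k : \bar R) g x : 0 <= k -> nnm g ->
  dil m (fun y => k * g y) x = k * dil m g x.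
Proof.
move=> k0 /(nnm_mulr x)[mg g0].
by rewrite /dil ge0_integralZl.
Qed.

Lemma dil_nneseries m (h : nat -> R -> \bar R) x : (forall n, nnm (h n)) ->
  dil m (fun y => \sum_(0 <= n <oo) h n y) x = \sum_(0 <= n <oo) dil m (h n) x.
Proof.
move=> hh; rewrite /dil integral_nneseries// => n; first by case: (nnm_mulr x (hh n)).
by move=> y _; case: (hh n).
Qed.

Lemma dilC m1 m2 g x : nnm g -> dil m1 (dil m2 g) x = dil m2 (dil m1 g) x.
Proof.
move=> ng; rewrite /dil.
rewrite (fubini_tonelli (fun z : R * R => g (x * z.1 * z.2)%R))/=; last 2 first.
- have -> : (fun z : R * R => g (x * z.1 * z.2)%R)
           = (fun y => g (x * y)%R) \o mulRR.
    by apply/funext => z; rewrite /= /mulRR mulrA.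
  apply: measurableT_comp; last exact: measurable_mulRR.
  by case: (nnm_mulr x ng).
- by move=> z; case: ng.
apply: eq_integral => v _; apply: eq_integral => u _.
by rewrite mulrAC.
Qed.

Lemma dil_add m1 m2 g x : nnm g -> dil (lfm_add m1 m2) g x = dil m1 g x + dil m2 g x.
Proof.
move=> /(nnm_mulr x)[mg g0].
by rewrite /dil [LHS]ge0_integral_measure_add.
Qed.

Lemma dil_conv m1 m2 g x : nnm g -> dil (lfm_conv m1 m2) g x = dil m1 (dil m2 g) x.
Proof.
move=> ng; have [mg g0] := nnm_mulr x ng.
rewrite /dil [LHS](ge0_integral_pushforward measurable_mulRR)//.
rewrite preimage_setT (fubini_tonelli1 (m1 := lfm_sf m1))/=; last 2 first.
- exact: (measurableT_comp mg measurable_mulRR).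
- by move=> z; apply: g0.
apply: eq_integral => u _; apply: eq_integral => v _.
by rewrite /= /mulRR mulrA.
Qed.

Lemma dil_dirac g x : nnm g -> dil lfm_dirac1 g x = g x.
Proof.
move=> /(nnm_mulr x)[mg g0].
by rewrite /dil [LHS]integral_dirac// diracT mul1e mulr1.
Qed.

Lemma dil0 g x : dil lfm0 g x = 0.
Proof. by rewrite /dil [LHS]integral_measure_zero. Qed.

Lemma dil_mexp (p : nat -> lfmeasure R) pf ps g x : nnm g ->
  dil (@LFMeasure R (mexp p) pf ps) g x =
  \sum_(0 <= n <oo) ((n`!%:R)^-1)%:E * dil (p n) g x.
Proof.
move=> /(nnm_mulr x)[mg g0].
rewrite /dil [LHS]ge0_integral_measure_series//.
by apply: eq_eseriesr => n _; rewrite [LHS]ge0_integral_mscale.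
Qed.

Lemma eq_dil m1 m2 g x : (forall X, measurable X -> m1 X = m2 X) ->
  dil m1 g x = dil m2 g x.
Proof.
by move=> m12; rewrite /dil; apply: eq_measure_integral => X mX _; exact: m12.
Qed.

(** The measure gives no mass to ]-oo, 1[, and x * u stays in [1, +oo[ when x and u do; a comparison
    on [1, +oo[ is therefore enough, and it can be iterated. *)
Lemma le_dil m g h x : nnm g -> nnm h -> (1 <= x)%R ->
  (forall y, (1 <= y)%R -> g y <= h y) -> dil m g x <= dil m h x.
Proof.
move=> /(nnm_mulr x)[mg g0] /(nnm_mulr x)[mh h0] x1 gh.
have mN : measurable (`]-oo, 1%R[ : set R) by [].
have N0 : lfm_sf m `]-oo, 1%R[ = 0 by exact: lfm_supp.
rewrite /dil (ge0_negligible_integral mN measurableT mg _ N0)//.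
rewrite [leRHS](ge0_negligible_integral mN measurableT mh _ N0)//.
apply: ge0_le_integral => //.
- exact: measurableD.
- exact: measurable_funTS.
- exact: measurable_funTS.
- move=> y [_]/=; rewrite in_itv/= => /negP; rewrite -leNgt => y1.
  by apply: gh; exact: mulr_ege1.
Qed.

End dilation_operators.

(** * Operators of signed measures and the law exp*(dA + dB) = exp*(dA) * exp*(dB) *)

Section signed_dilation.
Local Open Scope ereal_scope.
Context {R : realType}.
Implicit Types (m : lfmeasure R) (A B : smeasure R) (g h : bool -> R -> \bar R).

(* The boolean is a sign: [true] stands for the positive part of a signed measure. *)
Definition sdil A g (s : bool) (x : R) : \bar R :=
  dil (spos A) (g s) x + dil (sneg A) (g (~~ s)) x.

Local Notation snnm g := (forall s, nnm (g s)).

Lemma snnm_sdil A g : snnm g -> snnm (sdil A g).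
Proof. by move=> ng s; apply: nnmD; exact: nnm_dil. Qed.

Lemma snnmZ (k : \bar R) g : 0 <= k -> snnm g -> snnm (fun s x => k * g s x).
Proof. by move=> k0 ng s; exact: nnmZ. Qed.

Lemma snnm_nneseries (h : nat -> bool -> R -> \bar R) : (forall n, snnm (h n)) ->
  snnm (fun s x => \sum_(0 <= n <oo) h n s x).
Proof. by move=> hh s; apply: nnm_nneseries => n; exact: hh. Qed.

Lemma snnm_iter A g n : snnm g -> snnm (iter n (sdil A) g).
Proof. by move=> ng; elim: n => // n IH; exact: snnm_sdil. Qed.

Lemma sdil_ge0 A g s x : snnm g -> 0 <= sdil A g s x.
Proof. by move=> ng; case: (snnm_sdil A ng s). Qed.

Lemma sdilD A g h : snnm g -> snnm h ->
  sdil A (fun s x => g s x + h s x) = fun s x => sdil A g s x + sdil A h s x.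
Proof.
move=> ng nh; apply/funext => s; apply/funext => x.
by rewrite /sdil !dilD// addeACA.
Qed.

Lemma sdilZ A (k : \bar R) g : 0 <= k -> snnm g ->
  sdil A (fun s x => k * g s x) = fun s x => k * sdil A g s x.
Proof.
move=> k0 ng; apply/funext => s; apply/funext => x.
by rewrite /sdil !dilZ// [RHS]ge0_muleDr// dil_ge0.
Qed.

Lemma sdil_nneseries A (h : nat -> bool -> R -> \bar R) : (forall n, snnm (h n)) ->
  sdil A (fun s x => \sum_(0 <= n <oo) h n s x) =
  fun s x => \sum_(0 <= n <oo) sdil A (h n) s x.
Proof.
move=> hh; apply/funext => s; apply/funext => x.
rewrite /sdil !dil_nneseries => [|n|n]; try exact: hh.
by rewrite nneseriesD// => n _ _; exact: dil_ge0.
Qed.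

Lemma sdilC A B g : snnm g -> sdil A (sdil B g) = sdil B (sdil A g).
Proof.
move=> ng; apply/funext => s; apply/funext => x.
rewrite /sdil.
rewrite !(dilD _ _ (nnm_dil _ _) (nnm_dil _ _))//; try exact: ng.
rewrite negbK !(dilC (spos A)) ?(dilC (sneg A)); try exact: ng.
by rewrite addeACA [X in _ + X]addeC.
Qed.

Lemma sdil_add A B g : snnm g ->
  sdil (sadd A B) g = fun s x => sdil A g s x + sdil B g s x.
Proof.
move=> ng; apply/funext => s; apply/funext => x.
by rewrite /sdil /= !dil_add//; try exact: ng; rewrite addeACA.
Qed.

Lemma sdil_conv A B g : snnm g -> sdil (sconv A B) g = sdil A (sdil B g).
Proof.
move=> ng; apply/funext => s; apply/funext => x.
rewrite /sdil /= !dil_add ?dil_conv; try exact: ng.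
rewrite !(dilD _ _ (nnm_dil _ _) (nnm_dil _ _))//; try exact: ng.
by rewrite negbK addeACA [X in _ + X]addeC addeACA [X in _ + X]addeC.
Qed.

Lemma sdil_dirac g : snnm g -> sdil sdirac1 g = g.
Proof.
move=> ng; apply/funext => s; apply/funext => x.
by rewrite /sdil /= dil_dirac ?dil0 ?adde0; try exact: ng.
Qed.

Lemma sdil_convn A g n : snnm g -> sdil (sconvn A n) g = iter n (sdil A) g.
Proof.
move=> ng; elim: n => [|n IH]; first exact: sdil_dirac.
by rewrite [sconvn _ _]/= sdil_conv// IH.
Qed.

Definition icoef (n : nat) : \bar R := ((n`!%:R)^-1)%:E.

Lemma icoef_ge0 n : 0 <= icoef n.
Proof. by rewrite lee_fin. Qed.

Lemma sdil_exp A g : snnm g ->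
  sdil (sexp A) g = fun s x => \sum_(0 <= n <oo) icoef n * iter n (sdil A) g s x.
Proof.
move=> ng; apply/funext => s; apply/funext => x.
rewrite {1}/sdil /= !dil_mexp; try exact: ng.
rewrite -nneseriesD; last 2 first.
- by move=> n _ _; rewrite mule_ge0 ?dil_ge0//; exact: icoef_ge0.
- by move=> n _ _; rewrite mule_ge0 ?dil_ge0//; exact: icoef_ge0.
apply: eq_eseriesr => n _.
by rewrite -sdil_convn// /sdil [RHS]ge0_muleDr// dil_ge0.
Qed.

Lemma iter_sdilD A n g h : snnm g -> snnm h ->
  iter n (sdil A) (fun s x => g s x + h s x) =
  fun s x => iter n (sdil A) g s x + iter n (sdil A) h s x.
Proof.
move=> ng nh; elim: n => // n IH.
by rewrite !iterS IH sdilD//; exact: snnm_iter.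
Qed.

Lemma iter_sdilZ A n (k : \bar R) g : 0 <= k -> snnm g ->
  iter n (sdil A) (fun s x => k * g s x) = fun s x => k * iter n (sdil A) g s x.
Proof.
move=> k0 ng; elim: n => // n IH.
by rewrite !iterS IH sdilZ//; exact: snnm_iter.
Qed.

Lemma iter_sdil_nneseries A n (h : nat -> bool -> R -> \bar R) :
  (forall n, snnm (h n)) ->
  iter n (sdil A) (fun s x => \sum_(0 <= k <oo) h k s x) =
  fun s x => \sum_(0 <= k <oo) iter n (sdil A) (h k) s x.
Proof.
move=> hh; elim: n => // n IH.
by rewrite !iterS IH sdil_nneseries// => k; exact: snnm_iter.
Qed.

Lemma iter_sdilC A B g n : snnm g ->
  sdil B (iter n (sdil A) g) = iter n (sdil A) (sdil B g).
Proof.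
move=> ng; elim: n => // n IH.
by rewrite !iterS sdilC ?IH//; exact: snnm_iter.
Qed.

(** Binomial theorem for commuting operators S and T: [b n k j] stands for (S + T)^n S^k T^j applied
    to a fixed vector, and the hypothesis expands one factor S + T. Only addition is used, so that
    [V] may be the extended reals. *)
Lemma pascal_expansion (V : nmodType) (b : nat -> nat -> nat -> V) :
  (forall n k j, b n.+1 k j = (b n k.+1 j + b n k j.+1)%R) ->
  forall n k j, b n k j = (\sum_(i < n.+1) b 0%N (k + i)%N (j + (n - i))%N *+ 'C(n, i))%R.
Proof.
move=> bS; elim=> [|n IH] k j.
  by rewrite big_ord1 bin0 mulr1n addn0 addn0.
rewrite bS !IH [RHS]big_ord_recl [X in (_ + X)%R]big_ord_recl.
have -> : (\sum_(i < n.+1) b 0%N (k + bump 0 i)%N (j + (n.+1 - bump 0 i))%N *+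
             'C(n.+1, bump 0 i) =
  \sum_(i < n.+1) b 0%N (k.+1 + i)%N (j + (n - i))%N *+ 'C(n, i) +
  \sum_(i < n) b 0%N (k + bump 0 i)%N (j.+1 + (n - bump 0 i))%N *+ 'C(n, bump 0 i))%R.
  under eq_bigr do rewrite binS mulrnDr.
  rewrite big_split/= addrC; congr (_ + _)%R.
    by apply: eq_bigr => i _; rewrite addSn subSS addnS.
  rewrite big_ord_recr/= bin_small// mulr0n addr0.
  apply: eq_bigr => i _; rewrite /bump/= add1n; congr (b _ _ _ *+ _)%R.
  by rewrite subSS addSn -addnS -subSn// subSS.
by rewrite !bin0 !mulr1n !addn0 !subn0 addSn -addnS addrCA.
Qed.

(** Summation of a Cauchy product: extended by 0 for i > n, the terms form a full double series of
    nonnegative numbers, whose order of summation is free. *)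
Lemma nneseries_diagonal (f : nat -> nat -> \bar R) : (forall i j, 0 <= f i j) ->
  \sum_(0 <= n <oo) \sum_(i < n.+1) f i (n - i)%N =
  \sum_(0 <= i <oo) \sum_(0 <= j <oo) f i j.
Proof.
move=> f0; pose a n i := if (i <= n)%N then f i (n - i)%N else 0.
have a0 n i : 0 <= a n i by rewrite /a; case: ifP.
transitivity (\sum_(0 <= n <oo) \sum_(0 <= i <oo) a n i).
  apply: eq_eseriesr => n _.
  rewrite (@nneseries_split _ _ 0%N n.+1)// add0n.
  rewrite [X in _ + X]eseries0 ?adde0; last first.
    by move=> i ni _; rewrite /a leqNgt ni.
  rewrite big_mkord; apply: eq_bigr => i _.
  by rewrite /a -ltnS ltn_ord.
rewrite nneseries_interchange//; apply: eq_eseriesr => i _.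
rewrite (@nneseries_split _ _ 0%N i)// add0n big1_seq ?add0e; last first.
  by move=> n /andP[_]; rewrite mem_index_iota/= => ni; rewrite /a leqNgt ni.
rewrite -nneseries_addn//; apply: eq_eseriesr => j _.
by rewrite /a leq_addl addnK.
Qed.

Lemma iter_sdil_add A B g n s x : snnm g ->
  iter n (sdil (sadd A B)) g s x =
  (\sum_(i < n.+1) iter i (sdil A) (iter (n - i) (sdil B) g) s x *+ 'C(n, i))%R.
Proof.
move=> ng; pose b n k j :=
  iter n (sdil (sadd A B)) (iter k (sdil A) (iter j (sdil B) g)) s x.
have nn k j s' : nnm (iter k (sdil A) (iter j (sdil B) g) s').
  by do 2 apply: snnm_iter => ?.
rewrite -[LHS]/(b n 0%N 0%N) (@pascal_expansion _ b)// => m k j.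
rewrite /b iterSr sdil_add// iter_sdilD//; [|exact: snnm_sdil..].
by rewrite (iter_sdilC A B)//; exact: snnm_iter.
Qed.

Lemma icoef_bin n i : (i <= n)%N ->
  icoef n * ('C(n, i)%:R)%:E = icoef i * icoef (n - i).
Proof.
move=> ni; rewrite /icoef -!EFinM; congr EFin.
rewrite -(bin_fact ni) !natrM.
have c0 : ('C(n, i)%:R != 0 :> R)%R by rewrite pnatr_eq0 -lt0n bin_gt0.
have f0 k : (k`!%:R != 0 :> R)%R by rewrite pnatr_eq0 -lt0n fact_gt0.
by field; rewrite c0 !f0.
Qed.

(** The operators of A and B commute, so the binomial theorem applies to each power; C(n, i) / n! =
    1 / (i! (n - i)!) turns the series into a Cauchy product. *)
Lemma sdil_exp_add A B g : snnm g ->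
  sdil (sexp (sadd A B)) g = sdil (sexp A) (sdil (sexp B) g).
Proof.
move=> ng; apply/funext => s; apply/funext => x.
rewrite !sdil_exp//; last first.
  apply: snnm_nneseries => n; apply: snnmZ; first exact: icoef_ge0.
  exact: snnm_iter.
pose f i j := icoef i * (icoef j * iter i (sdil A) (iter j (sdil B) g) s x).
have f0 i j : 0 <= f i j.
  rewrite !mule_ge0 ?icoef_ge0//.
  by have [] := @snnm_iter A _ i (fun s' => @snnm_iter B _ j ng s') s.
have natmulE (y : \bar R) k : (y *+ k)%R = k%:R%:E * y by rewrite mule_natl.
transitivity (\sum_(0 <= n <oo) \sum_(i < n.+1) f i (n - i)%N).
  apply: eq_eseriesr => n _; rewrite iter_sdil_add// ge0_sume_distrr.
    apply: eq_bigr => i _; rewrite natmulE muleA icoef_bin -?muleA//.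
    by rewrite -ltnS.
  move=> i _; rewrite natmulE mule_ge0//.
  by have [] := @snnm_iter A _ i (fun s' => @snnm_iter B _ (n - i) ng s') s.
rewrite nneseries_diagonal//; apply: eq_eseriesr => i _.
rewrite iter_sdil_nneseries; last first.
  by move=> n; apply: snnmZ; [exact: icoef_ge0|exact: snnm_iter].
rewrite /f nneseriesZl; last first.
  move=> j _; rewrite mule_ge0 ?icoef_ge0//.
  by have [] := @snnm_iter A _ i (fun s' => @snnm_iter B _ j ng s') s.
congr (_ * _); apply: eq_eseriesr => j _.
rewrite iter_sdilZ//; first exact: icoef_ge0.
exact: snnm_iter.
Qed.

End signed_dilation.

(** * Primitives as values of operators, and independence of the chosen decomposition *)

Section signed_primitive.
Local Open Scope ereal_scope.
Context {R : realType}.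
Implicit Types (m : lfmeasure R) (A B : smeasure R) (g h : bool -> R -> \bar R).

Local Notation snnm g := (forall s, nnm (g s)).

Lemma le_sdil A g h : snnm g -> snnm h ->
  (forall s y, (1 <= y)%R -> g s y <= h s y) ->
  forall s x, (1 <= x)%R -> sdil A g s x <= sdil A h s x.
Proof.
move=> ng nh gh s x x1; apply: leeD; apply: le_dil => // y; exact: gh.
Qed.

Lemma eq_sdil A B g :
  (forall X, measurable X -> spos A X = spos B X) ->
  (forall X, measurable X -> sneg A X = sneg B X) -> sdil A g = sdil B g.
Proof.
move=> pE nE; apply/funext => s; apply/funext => x.
by congr (_ + _); exact: eq_dil.
Qed.

Lemma eq_sdil_exp A B g : snnm g ->
  (forall X, measurable X -> spos A X = spos B X) ->
  (forall X, measurable X -> sneg A X = sneg B X) ->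
  sdil (sexp A) g = sdil (sexp B) g.
Proof.
move=> ng pE nE; rewrite !sdil_exp//.
suff -> : sdil A = sdil B by [].
by apply/funext => h; exact: eq_sdil.
Qed.

(** Test function that vanishes on the negative sign: at the sign [true] the operator of A then
    reads off [spos A], at [false] it reads off [sneg A]. *)
Definition ray (x : R) (s : bool) (u : R) : \bar R :=
  if s then (\1_(`]-oo, x]) u)%:E else 0.

Lemma nnm_indic (X : set R) : measurable X -> nnm (fun u => (\1_X u)%:E).
Proof.
move=> mX; split; last by move=> u; rewrite lee_fin.
by apply/measurable_EFinP; exact: measurable_indic.
Qed.

Lemma snnm_ray x : snnm (ray x).
Proof. by case; [exact: nnm_indic|exact: nnm_cst]. Qed.

Lemma lfm_itv m (x : R) : m `]-oo, x]%classic = m `[1%R, x]%classic.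
Proof.
apply/eqP; rewrite eq_le; apply/andP; split; last first.
  apply: le_measure; rewrite ?inE//= => y /=; rewrite !in_itv/=.
  by case/andP.
apply: (@le_trans _ _ (m (`]-oo, 1%R[%classic `|` `[1%R, x]%classic))).
  apply: le_measure; rewrite ?inE//=; first exact: measurableU.
  move=> y /=; rewrite !in_itv/= => yx.
  by case: (ltP y 1%R) => y1; [left|right]; rewrite /= ?yx.
apply: le_trans (measureU2 _ _ _) _ => //=.
by rewrite [X in X + _](lfm_supp m) add0e.
Qed.

Lemma dil_ray m (x y : R) : (0 < y)%R -> dil m (ray x true) y = m `[1%R, (x / y)%R]%classic.
Proof.
move=> y0; rewrite -lfm_itv -[X in m X]setIT -(@integral_indic _ _ _ m)//.
apply: eq_integral => u _; rewrite /ray !indicE; congr ((nat_of_bool _)%:R)%:E.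
by rewrite !mem_setE; rewrite !in_itv/= ler_pdivlMr// mulrC.
Qed.

Lemma sdil_ray_true A (x y : R) : (0 < y)%R ->
  sdil A (ray x) true y = spos A `[1%R, (x / y)%R]%classic.
Proof.
move=> y0; rewrite /sdil dil_ray//= [X in _ + X](_ : _ = 0) ?adde0//.
by rewrite /dil /ray integral0.
Qed.

Lemma sdil_ray_false A (x y : R) : (0 < y)%R ->
  sdil A (ray x) false y = sneg A `[1%R, (x / y)%R]%classic.
Proof.
move=> y0; rewrite /sdil dil_ray//= [X in X + _](_ : _ = 0) ?add0e//.
by rewrite /dil /ray integral0.
Qed.

Lemma primitiveE A x : primitive A x =
  (fine (sdil A (ray x) true 1) - fine (sdil A (ray x) false 1))%R.
Proof. by rewrite sdil_ray_true// sdil_ray_false// divr1. Qed.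

Lemma sdil_ray_fin A x s : sdil A (ray x) s 1 \is a fin_num.
Proof.
rewrite ge0_fin_numE ?sdil_ge0//; last exact: snnm_ray.
by case: s; rewrite ?sdil_ray_true// ?sdil_ray_false// lfm_fin.
Qed.

Lemma fine_subDr (a b c : \bar R) : a \is a fin_num -> b \is a fin_num ->
  c \is a fin_num -> (fine (a + c) - fine (b + c) = fine a - fine b)%R.
Proof. by move=> fa fb fc; rewrite !fineD// opprD addrACA subrr addr0. Qed.

(* Every convolution power of (m, m) other than the zeroth is symmetric in the sign,
   hence invisible in a primitive. *)
Lemma primitive_sexp_cancel A m x :
  primitive (sexp (sadd A (SMeasure m m))) x = primitive (sexp A) x.
Proof.
set C := SMeasure m m.
have nr := snnm_ray x.
pose h s y := \sum_(0 <= n <oo) @icoef R n.+1 * iter n.+1 (sdil C) (ray x) s y.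
have nh s : nnm (h s).
  apply: (@snnm_nneseries _ (fun n s y => @icoef R n.+1 * iter n.+1 (sdil C) (ray x) s y)).
  by move=> n s'; apply: snnmZ; [exact: icoef_ge0|exact: snnm_iter].
have hE s : h (~~ s) = h s.
  apply/funext => y; apply: eq_eseriesr => n _; congr (_ * _).
  by rewrite iterS /sdil /= negbK addeC.
have expC : sdil (sexp C) (ray x) = fun s y => ray x s y + h s y.
  rewrite sdil_exp//; apply/funext => s; apply/funext => y.
  have pos n : 0 <= @icoef R n * iter n (sdil C) (ray x) s y.
    by rewrite mule_ge0 ?icoef_ge0//; case: (snnm_iter C n nr s).
  rewrite nneseries_recl// {1}/icoef/= fact0 invr1 mul1e; congr (_ + _).
  by rewrite -nneseries_addn//; apply: eq_eseriesr => n _; rewrite addn1.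
have E s : sdil (sexp (sadd A C)) (ray x) s 1 =
    sdil (sexp A) (ray x) s 1 + sdil (sexp A) h s 1.
  by rewrite sdil_exp_add// expC sdilD.
have EH : sdil (sexp A) h false 1 = sdil (sexp A) h true 1.
  by rewrite /sdil /= (hE true).
(* Finiteness of the term common to both signs, which allows it to cancel in the difference. *)
have fh : sdil (sexp A) h true 1 \is a fin_num.
  have := sdil_ray_fin (sexp (sadd A C)) x true.
  by rewrite (E true) fin_numD => /andP[].
rewrite (primitiveE (sexp (sadd A C))) (primitiveE (sexp A)) (E true) (E false) EH.
by apply: fine_subDr; [exact: sdil_ray_fin..|exact: fh].
Qed.

(* Equality of signed measures, without subtraction as the values may be +oo. *)
Definition seqv A B := forall X, measurable X ->
  spos A X + sneg B X = spos B X + sneg A X.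

(** Adding [sneg B] to both parts of A and [sneg A] to both parts of B changes neither primitive,
    and makes the two pairs equal component by component. *)
Lemma primitive_sexp_seqv A B x : seqv A B ->
  primitive (sexp A) x = primitive (sexp B) x.
Proof.
move=> AB; rewrite -(primitive_sexp_cancel A (sneg B)).
rewrite -(primitive_sexp_cancel B (sneg A)) !primitiveE.
rewrite (@eq_sdil_exp _ (sadd B (SMeasure (sneg A) (sneg A))))//.
- exact: snnm_ray.
- by move=> X mX; rewrite /= !lfm_addE AB.
- by move=> X mX; rewrite /= !lfm_addE addeC.
Qed.

End signed_primitive.

(** * Jordan decomposition of a locally finite signed measure *)

Section jordan.
Local Open Scope ereal_scope.
Context {R : realType}.
Variable A : smeasure R.

Let hahn n := projT2 (cid (projT2 (cid (Hahn_decomposition (spiece A n))))).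
Let jpos n : {measure set R -> \bar R} := jordan_pos (hahn n).
Let jneg n : {measure set R -> \bar R} := jordan_neg (hahn n).
Let mpos : {measure set R -> \bar R} := mseries jpos 0.
Let mneg : {measure set R -> \bar R} := mseries jneg 0.

Let mvarE X : mpos X + mneg X = mvar A X.
Proof. by rewrite -[LHS]nneseriesD. Qed.

Let mpos_le X : mpos X <= mvar A X. Proof. by rewrite -mvarE leeDl. Qed.
Let mneg_le X : mneg X <= mvar A X. Proof. by rewrite -mvarE leeDr. Qed.

Let mpos_fin (x : R) : mpos `[1%R, x]%classic < +oo.
Proof. exact: le_lt_trans (mpos_le _) (svar_fin A x). Qed.

Let mneg_fin (x : R) : mneg `[1%R, x]%classic < +oo.
Proof. exact: le_lt_trans (mneg_le _) (svar_fin A x). Qed.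

Let mpos_supp : mpos `]-oo, 1%R[%classic = 0.
Proof. by apply/eqP; rewrite eq_le measure_ge0 andbT -(svar_supp A) mpos_le. Qed.

Let mneg_supp : mneg `]-oo, 1%R[%classic = 0.
Proof. by apply/eqP; rewrite eq_le measure_ge0 andbT -(svar_supp A) mneg_le. Qed.

Let piece_jordan n X : measurable X ->
  lfm_piece (spos A) n X + jneg n X = jpos n X + lfm_piece (sneg A) n X.
Proof.
move=> mX; have h : spiece A n X = jpos n X - jneg n X.
  by rewrite (jordan_decomp (hahn n) mX) /cadd/= cscaleN1.
have {h} : lfm_piece (spos A) n X - lfm_piece (sneg A) n X = jpos n X - jneg n X := h.
have /fineK <- := lfm_piece_fin (spos A) n mX.
have /fineK <- := lfm_piece_fin (sneg A) n mX.
have /fineK <- : jpos n X \is a fin_num by exact: fin_num_measure.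
have /fineK <- : jneg n X \is a fin_num by exact: fin_num_measure.
rewrite -!EFinB -!EFinD => -[h]; congr EFin.
by apply/eqP; rewrite -subr_eq addrAC h subrK.
Qed.

(** The Jordan parts are taken on each piece [n, n + 1[, where the measure is a finite charge, and
    summed over n. The equivalence with A is checked on each piece, where all values are finite and
    subtraction is legitimate. *)
Lemma smeasure_jordan : exists2 J : smeasure R,
  (forall X, spos J X + sneg J X = svar A X) & seqv A J.
Proof.
exists (SMeasure (LFMeasure mpos_fin mpos_supp) (LFMeasure mneg_fin mneg_supp)).
  exact: mvarE.
move=> X mX; rewrite (lfm_pieces _ mX) [X in _ = _ + X](lfm_pieces _ mX) /=.
rewrite -[LHS]nneseriesD// -[RHS]nneseriesD//.
by apply: eq_eseriesr => n _; exact: piece_jordan.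
Qed.

End jordan.

(** * Bounding the primitive of exp*(dB + dA) by an integral of the primitive of exp*(dA) *)

Section reduction.
Local Open Scope ereal_scope.
Context {R : realType}.
Implicit Types (A B : smeasure R).

(* It bounds |dA|, with equality only if (spos A, sneg A) is the Jordan decomposition. *)
Definition sabs A : lfmeasure R := lfm_add (spos A) (sneg A).

Lemma sdil_even A (h : R -> \bar R) s : nnm h ->
  sdil A (fun=> h) s = dil (sabs A) h.
Proof. by move=> nh; apply/funext => x; rewrite /sdil dil_add. Qed.

(** For nonzero u the inverse is exp(- ln |u|) up to sign, and the inverse of 0 is 0 by
    convention. *)
Lemma measurable_invr : measurable_fun [set: R] (fun u : R => (u^-1)%R).
Proof.
rewrite (_ : (fun u => _) = (fun u : R => if (0 < u)%R then expR (- ln u)%R else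
  if (u < 0)%R then (- expR (- ln (- u)))%R else 0%R)); last first.
  apply/funext => u; case: ltgtP => u0; last by rewrite -u0 invr0.
    by rewrite expRN lnK// posrE.
  by rewrite expRN lnK ?posrE ?oppr_gt0// invrN opprK.
have mN : measurable_fun [set: R] (fun u : R => (- u)%R) by exact: measurable_funN.
apply: measurable_fun_ifT; first exact: measurable_fun_ltr.
  by do 2 apply: measurableT_comp => //; exact: measurable_ln.
apply: measurable_fun_ifT => //; first exact: measurable_fun_ltr.
do 3 apply: measurableT_comp => //.
by apply: measurableT_comp => //; exact: measurable_ln.
Qed.

Lemma measurable_divr (x : R) : measurable_fun [set: R] (fun u : R => (x / u)%R).
Proof. by apply: measurable_funM => //; exact: measurable_invr. Qed.

Lemma measurable_primitive A : measurable_fun [set: R] (primitive A).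
Proof.
apply: measurable_funB; apply: nondecreasing_measurable => // y z yz;
  (apply: fine_le; [by rewrite ge0_fin_numE// lfm_fin..|]);
  by apply: le_measure; rewrite ?inE//=; apply: subset_itvl; rewrite bnd_simp.
Qed.

(** Once exp*(A) has acted on [ray x], its two sign components at y >= 1 differ by m y in absolute
    value. Each is thus at most the other plus m y, an inequality that the positive operator of
    exp*(B) preserves. *)
Lemma primitive_exp_le A B x : `|primitive (sexp (sadd B A)) x|%:E <=
  dil (sabs (sexp B)) (fun u => `|primitive (sexp A) (x / u)|%:E) 1.
Proof.
set m := (X in dil _ X _).
have nm : nnm m.
  split; last by move=> u; rewrite lee_fin.
  apply/measurable_EFinP; apply: measurableT_comp => //.
  apply: (measurableT_comp (measurable_primitive _)); exact: measurable_divr.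
pose g := sdil (sexp A) (ray x).
have ng s : nnm (g s) by apply: snnm_sdil; exact: snnm_ray.
have E s : sdil (sexp (sadd B A)) (ray x) s 1 = sdil (sexp B) g s 1.
  by rewrite sdil_exp_add//; exact: snnm_ray.
have gm s y : (1 <= y)%R -> g s y <= g (~~ s) y + m y.
  move=> y1; have y0 : (0 < y)%R by exact: lt_le_trans y1.
  have fin l : (l : lfmeasure R) `[1%R, (x / y)%R]%classic \is a fin_num.
    by rewrite ge0_fin_numE// lfm_fin.
  rewrite /m /primitive /signed_val.
  case: s => /=; rewrite /g sdil_ray_true// sdil_ray_false//.
    rewrite -[leLHS]fineK// -[X in _ <= X + _]fineK// -EFinD lee_fin.
    by rewrite -lerBlDl ler_norm.
  rewrite -[leLHS]fineK// -[X in _ <= X + _]fineK// -EFinD lee_fin.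
  by rewrite -lerBlDl distrC ler_norm.
have le s : sdil (sexp B) g s 1 <=
    sdil (sexp B) g (~~ s) 1 + dil (sabs (sexp B)) m 1.
  rewrite -(sdil_even _ s)//.
  (* Exchanging the signs commutes with every [sdil], by definition. *)
  have -> : sdil (sexp B) g (~~ s) 1 = sdil (sexp B) (fun s => g (~~ s)) s 1 by [].
  rewrite -[leRHS]/((fun s x => sdil (sexp B) (fun s => g (~~ s)) s x + _ s x) s 1%R).
  rewrite -sdilD//; apply: le_sdil => // s'; exact: nnmD.
(* If the bound is finite, the two inequalities can be rearranged in the reals. *)
have [->|fm] := eqVneq (dil (sabs (sexp B)) m 1) +oo; first by rewrite leey.
have {}fm : dil (sabs (sexp B)) m 1 \is a fin_num.
  by rewrite ge0_fin_numE ?ltey//; exact: dil_ge0.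
have fs s : sdil (sexp B) g s 1 \is a fin_num by rewrite -E sdil_ray_fin.
have := le true; have := le false; rewrite primitiveE !E /=.
rewrite -(fineK fm) -(fineK (fs true)) -(fineK (fs false)) -!EFinD !lee_fin /=.
move=> l1 l2; rewrite ler_norml lerBlDl l2 andbT.
by rewrite lerBrDr addrC lerBlDr.
Qed.

End reduction.

(** * Growth and Leibniz inequalities for exponentials *)

Section exp_functional.
Local Open Scope ereal_scope.
Context {R : realType}.
Implicit Types (m : lfmeasure R) (A B : smeasure R) (g h : R -> \bar R).

Lemma nnm_iter m g n : nnm g -> nnm (iter n (dil m) g).
Proof. by move=> ng; elim: n => // n IH; exact: nnm_dil. Qed.

Lemma iter_sdil_even A h n s : nnm h ->
  iter n (sdil A) (fun=> h) s = iter n (dil (sabs A)) h.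
Proof.
move=> nh; suff -> : iter n (sdil A) (fun=> h) = (fun=> iter n (dil (sabs A)) h) by [].
elim: n => // n IH; apply/funext => s'.
by rewrite !iterS IH sdil_even//; exact: nnm_iter.
Qed.

(** On functions blind to the sign, the sum of the two parts of exp*(A) acts as the exponential of
    the positive measure [sabs A]. *)
Lemma dil_sabs_exp A h x : nnm h ->
  dil (sabs (sexp A)) h x = \sum_(0 <= n <oo) icoef n * iter n (dil (sabs A)) h x.
Proof.
move=> nh; rewrite -(sdil_even _ true)// sdil_exp//.
by apply: eq_eseriesr => n _; rewrite iter_sdil_even.
Qed.

Lemma dil_sabs_exp_add A B h x : nnm h ->
  dil (sabs (sexp (sadd A B))) h x = dil (sabs (sexp A)) (dil (sabs (sexp B)) h) x.
Proof.
move=> nh; rewrite -(sdil_even _ true)// sdil_exp_add//.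
rewrite -(sdil_even (sexp A) true (nnm_dil (sabs (sexp B)) nh)).
congr (sdil _ _ _ _); apply/funext => s.
by rewrite sdil_even.
Qed.

Lemma nneseries_exp (r : R) : \sum_(0 <= n <oo) (exp_coeff r n)%:E = (expR r)%:E.
Proof.
apply/cvg_lim => //; under eq_fun do rewrite sumEFin.
apply: cvg_EFin; first by near=> n.
exact: is_cvg_series_exp_coeff.
Unshelve. all: by end_near. Qed.

(** If T h <= K h for a positive operator T, then T^n h <= K^n h, and the exponential series sums to
    exp(K) h. *)
Lemma dil_exp_le A (h : R -> R) (K : R) : (0 <= K)%R -> nnm (fun u => (h u)%:E) ->
  (forall x, (1 <= x)%R -> dil (sabs A) (fun u => (h u)%:E) x <= (K * h x)%:E) ->
  forall x, (1 <= x)%R ->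
  dil (sabs (sexp A)) (fun u => (h u)%:E) x <= (expR K * h x)%:E.
Proof.
move=> K0 nh hK x x1.
have h0 y : (0 <= h y)%R by have [_ /(_ y)] := nh; rewrite lee_fin.
have iter_le n y : (1 <= y)%R ->
    iter n (dil (sabs A)) (fun u => (h u)%:E) y <= (K ^+ n * h y)%:E.
  elim: n y => [|n IH] y y1; first by rewrite expr0 mul1r.
  rewrite iterS; apply: (@le_trans _ _
      (dil (sabs A) (fun u => (K ^+ n)%:E * (h u)%:E) y)).
    apply: le_dil => //; first exact: nnm_iter.
    by apply: nnmZ => //; rewrite lee_fin exprn_ge0.
  rewrite dilZ ?lee_fin ?exprn_ge0// exprSr -mulrA EFinM.
  by rewrite lee_wpmul2l ?lee_fin ?exprn_ge0// hK.
rewrite dil_sabs_exp// mulrC EFinM -nneseries_exp -nneseriesZl//; last first.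
  by move=> n _; rewrite lee_fin exp_coeff_ge0.
apply: lee_nneseries => [n _ _|n _].
  by rewrite mule_ge0 ?icoef_ge0//; case: (nnm_iter (sabs A) n nh).
apply: (@le_trans _ _ (icoef n * (K ^+ n * h x)%:E)).
  by rewrite lee_wpmul2l ?icoef_ge0// iter_le.
by rewrite /icoef -!EFinM lee_fin /exp_coeff/= mulrC mulrAC mulrC mulrA.
Qed.

(* [lnp u] and [inv1 u] are log u and 1/u on the support [1, +oo[ of the measures,
   truncated elsewhere so as to be nonnegative. *)
Definition lnp (u : R) : R := ln (Num.max 1 u)%R.

Lemma lnp_ge0 u : (0 <= lnp u)%R.
Proof. by rewrite ln_ge0// le_max lexx. Qed.

Lemma measurable_lnp : measurable_fun [set: R] lnp.
Proof.
apply: measurableT_comp; first exact: measurable_ln.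
exact: measurable_maxr.
Qed.

Lemma nnmE (h : R -> R) : measurable_fun [set: R] h -> (forall u, 0 <= h u)%R ->
  nnm (fun u => (h u)%:E).
Proof. by move=> mh h0; split; [exact/measurable_EFinP|move=> u; rewrite lee_fin]. Qed.

Lemma nnm_lnp : nnm (fun u => (lnp u)%:E).
Proof. apply: nnmE; [exact: measurable_lnp|exact: lnp_ge0]. Qed.

Lemma lnp1 : lnp 1 = 0%R. Proof. by rewrite /lnp maxxx ln1. Qed.

Lemma lnpM (x u : R) : (1 <= x)%R -> (1 <= u)%R -> lnp (x * u) = (lnp x + lnp u)%R.
Proof.
move=> x1 u1; rewrite /lnp !max_r ?mulr_ege1// lnM// posrE.
  exact: lt_le_trans x1.
exact: lt_le_trans u1.
Qed.

(** The dilation operator of the measure log u dm(u). *)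
Definition ldil m h (x : R) : \bar R := \int[lfm_sf m]_u ((lnp u)%:E * h (x * u)%R).

Lemma nnm_ldil m h : nnm h -> nnm (ldil m h).
Proof.
move=> nh; have [mh h0] := nh; have [ml l0] := nnm_lnp.
split; last by move=> x; apply: integral_ge0 => u _; rewrite mule_ge0.
apply: (measurable_fun_fubini_tonelli_F (fun z : R * R => (lnp z.2)%:E * h (z.1 * z.2)%R)).
- apply: emeasurable_funM; last exact: nnm_mulRR.
  by apply: (measurableT_comp (f := fun u => (lnp u)%:E)) => //; exact: measurable_snd.
- by move=> z; rewrite mule_ge0.
Qed.

Lemma dil_ldilC m h x : nnm h -> ldil m (dil m h) x = dil m (ldil m h) x.
Proof.
move=> nh; have [ml l0] := nnm_lnp; have [mxh xh0] := nnm_mulr x nh.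
have mh2 : measurable_fun [set: R * R] (fun z : R * R => h (x * (z.1 * z.2))%R).
  by have := @nnm_mulRR R (fun y => h (x * y)%R) (conj mxh xh0).
rewrite /dil [RHS](fubini_tonelli
  (fun z : R * R => (lnp z.2)%:E * h (x * z.1 * z.2)%R)) /=; last 2 first.
- apply: emeasurable_funM.
    by apply: (measurableT_comp (f := fun u => (lnp u)%:E)) => //; exact: measurable_snd.
  by under eq_fun do rewrite -mulrA.
- by move=> z; rewrite mule_ge0//; case: nh.
apply: eq_integral => v _; rewrite ge0_integralZl//.
- by congr (_ * _); apply: eq_integral => u _; rewrite mulrAC.
- under eq_fun do rewrite -mulrA (mulrC _ v) mulrA.
  by case: (nnm_mulr (x * v) nh).
- by move=> u _; case: nh.
Qed.

Lemma iter_ldilC m h n : nnm h -> ldil m (iter n (dil m) h) = iter n (dil m) (ldil m h).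
Proof.
move=> nh; elim: n => // n IH; rewrite !iterS -IH; apply/funext => x.
by rewrite dil_ldilC//; exact: nnm_iter.
Qed.

(* Leibniz rule: multiplication by log is a derivation for the convolution. *)
Lemma dil_lnp_le m h x : nnm h -> (1 <= x)%R ->
  dil m (fun u => (lnp u)%:E * h u) x <= (lnp x)%:E * dil m h x + ldil m h x.
Proof.
move=> nh x1; have [mxh xh0] := nnm_mulr x nh; have [ml l0] := nnm_lnp.
rewrite /dil /ldil -ge0_integralZl// ?lee_fin ?lnp_ge0// -ge0_integralD//; last 4 first.
- by move=> u _; rewrite mule_ge0.
- by apply: emeasurable_funM => //; exact: measurable_cst.
- by move=> u _; rewrite mule_ge0.
- exact: emeasurable_funM.
have mN : measurable (`]-oo, 1%R[ : set R) by [].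
have N0 : lfm_sf m `]-oo, 1%R[%classic = 0 by exact: lfm_supp.
have [m1 p1] : nnm (fun u => (lnp (x * u))%:E * h (x * u)%R).
  by apply: (@nnm_mulr _ (fun y => (lnp y)%:E * h y)); apply: nnmM => //; exact: nnm_lnp.
have [m2 p2] : nnm (fun u => (lnp x)%:E * h (x * u)%R + (lnp u)%:E * h (x * u)%R).
  apply: nnmD; last by apply: nnmM => //; exact: nnm_lnp.
  by apply: nnmZ => //; rewrite lee_fin lnp_ge0.
rewrite (ge0_negligible_integral mN measurableT m1 _ N0)//.
rewrite [leRHS](ge0_negligible_integral mN measurableT m2 _ N0)//.
apply: ge0_le_integral => //.
- exact: measurableD.
- exact: measurable_funTS.
- exact: measurable_funTS.
- move=> y [_]/=; rewrite in_itv/= => /negP; rewrite -leNgt => y1.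
  by rewrite lnpM// EFinD ge0_muleDl.
Qed.

(** Iterated Leibniz rule, the factor n arising because [ldil m] commutes with [dil m]. For n = 0
    the coefficient 0 neutralises the default value of [n.-1]. *)
Lemma iter_dil_lnp_le m h n x : nnm h -> (1 <= x)%R ->
  iter n (dil m) (fun u => (lnp u)%:E * h u) x <=
  (lnp x)%:E * iter n (dil m) h x + n%:R%:E * iter n.-1 (dil m) (ldil m h) x.
Proof.
move=> nh; have nl := nnm_lnp; have nld := nnm_ldil m nh.
have nlh : nnm (fun u => (lnp u)%:E * h u) by exact: nnmM.
elim: n x => [|n IH] x x1; first by rewrite /= mul0e adde0.
rewrite iterS; apply: (@le_trans _ _ (dil m (fun x =>
    (lnp x)%:E * iter n (dil m) h x + n%:R%:E * iter n.-1 (dil m) (ldil m h) x) x)).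
  apply: le_dil => //; first exact: nnm_iter.
  apply: nnmD; first by apply: nnmM => //; exact: nnm_iter.
  by apply: nnmZ => //; exact: nnm_iter.
rewrite dilD; last 2 first.
- by apply: nnmM => //; exact: nnm_iter.
- by apply: nnmZ => //; exact: nnm_iter.
rewrite dilZ//; last exact: nnm_iter.
apply: (@le_trans _ _ ((lnp x)%:E * dil m (iter n (dil m) h) x +
   ldil m (iter n (dil m) h) x + n%:R%:E * dil m (iter n.-1 (dil m) (ldil m h)) x)).
  by apply: leeD => //; apply: dil_lnp_le => //; exact: nnm_iter.
rewrite iter_ldilC// -addeA; apply: leeD => //=.
case: n {IH} => [|n]; first by rewrite /= mul0e adde0 mul1e.
rewrite -[in X in X <= _]/(iter n.+1 (dil m) (ldil m h) x).
by rewrite -[X in X + _]mul1e -ge0_muleDl//.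
Qed.

(** Inequality form of log . exp*(m) = (log . m) * exp*(m) with m = [sabs A]: at the point 1 the
    term in log x vanishes, and n / n! = 1 / (n - 1)! shifts the series by one. *)
Lemma dil_exp_lnp_le A h : nnm h ->
  dil (sabs (sexp A)) (fun u => (lnp u)%:E * h u) 1 <=
  dil (sabs (sexp A)) (ldil (sabs A) h) 1.
Proof.
move=> nh; have nld := nnm_ldil (sabs A) nh.
have nlh : nnm (fun u => (lnp u)%:E * h u) by apply: nnmM => //; exact: nnm_lnp.
have pos (g : R -> \bar R) n : nnm g -> 0 <= icoef n * iter n (dil (sabs A)) g 1%R.
  by move=> ng; rewrite mule_ge0 ?icoef_ge0//; case: (nnm_iter (sabs A) n ng).
rewrite !dil_sabs_exp// nneseries_recl//=; last by move=> n _; exact: pos.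
rewrite lnp1 mul0e mule0 add0e -nneseries_addn//; last by move=> n; exact: pos.
apply: lee_nneseries => [n _ _|n _]; first exact: pos.
rewrite addn1; apply: (@le_trans _ _ (icoef n.+1 * (n.+1%:R%:E *
   iter n (dil (sabs A)) (ldil (sabs A) h) 1%R))).
  rewrite lee_wpmul2l ?icoef_ge0//.
  have := iter_dil_lnp_le (sabs A) n.+1 nh (lexx 1%R).
  by rewrite lnp1 mul0e add0e.
rewrite muleA /icoef -EFinM factS natrM invfM mulrAC mulVf ?mul1r//.
Qed.

End exp_functional.

(** * Integrals of 1/u and log u / u over windows, for a measure with mass o(x / log x) *)

Section windows.
Context {R : realType}.
Variable e : lfmeasure R.
Implicit Types (h : R -> R) (a b c x y u : R).

Definition mass x : R := fine (e `[1, x]%classic).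

Lemma massE x : e `[1, x]%classic = (mass x)%:E.
Proof. by rewrite fineK// ge0_fin_numE// lfm_fin. Qed.

Lemma mass_ge0 x : 0 <= mass x.
Proof. by rewrite fine_ge0. Qed.

Lemma le_mass : {homo mass : x y / x <= y}.
Proof.
move=> x y xy; rewrite -lee_fin -!massE; apply: le_measure; rewrite ?inE//=.
by apply: subset_itvl; rewrite bnd_simp.
Qed.

Definition inv1 u : R := (Num.max 1 u)^-1.

Lemma inv1_ge0 u : 0 <= inv1 u.
Proof. by rewrite invr_ge0 le_max ler01. Qed.

Lemma inv1E u : 1 <= u -> inv1 u = u^-1.
Proof. by move=> u1; rewrite /inv1 max_r. Qed.

Lemma measurable_inv1 : measurable_fun [set: R] inv1.
Proof.
apply: (measurableT_comp (f := fun u : R => u^-1)); first exact: measurable_invr.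
exact: measurable_maxr.
Qed.

Definition win a b h u : R := if (a <= u) && (u <= b) then h u else 0.

Lemma win_ge0 a b h u : (forall u, 0 <= h u) -> 0 <= win a b h u.
Proof. by move=> h0; rewrite /win; case: ifP. Qed.

Lemma nnm_win a b h : measurable_fun [set: R] h -> (forall u, 0 <= h u) ->
  nnm (fun u => (win a b h u)%:E).
Proof.
move=> mh h0; apply: nnmE; last by move=> u; exact: win_ge0.
apply: measurable_fun_ifT => //.
by apply: measurable_and; exact: measurable_fun_ler.
Qed.

Lemma dil_win_le a b h c : measurable_fun [set: R] h -> (forall u, 0 <= h u) ->
  0 <= c -> (forall u, 1 <= u -> a <= u -> u <= b -> h u <= c) ->
  (dil e (fun u => (win a b h u)%:E) 1 <= (c * mass b)%:E)%E.
Proof.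
move=> mh h0 c0 hc.
rewrite EFinM -massE -[in leRHS](divr1 b) -dil_ray// -dilZ//; last exact: (snnm_ray _ true).
apply: le_dil => //; first exact: nnm_win.
  by apply: nnmZ => //; exact: (snnm_ray _ true).
move=> u u1; rewrite /win /ray -EFinM lee_fin indicE mem_setE in_itv/=.
case: ifP => [/andP[au ub]|_]; first by rewrite ub mulr1 hc.
by rewrite mulr_ge0.
Qed.

Lemma dil_win_split a b c h : measurable_fun [set: R] h -> (forall u, 0 <= h u) ->
  (dil e (fun u => (win a c h u)%:E) 1 <=
   dil e (fun u => (win a b h u)%:E) 1 + dil e (fun u => (win b c h u)%:E) 1)%E.
Proof.
move=> mh h0; rewrite -dilD; [|exact: nnm_win..].
apply: le_dil => //; first exact: nnm_win.
  by apply: nnmD; exact: nnm_win.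
move=> u u1; rewrite -EFinD lee_fin /win.
case: (leP a u) => au /=; last first.
  by rewrite add0r; case: ifP.
case: (leP u c) => uc /=; last by rewrite andbF addr0; case: ifP.
case: (leP u b) => ub /=; first by rewrite lerDl; case: ifP.
by rewrite (ltW ub) /= add0r.
Qed.

Lemma ln_ge (t : R) : 0 < t -> (t + 1)^-1 <= ln (t + 1) - ln t.
Proof.
move=> t0; have t1 : 0 < t + 1 by rewrite addr_gt0.
have := @le_ln1Dx R (t / (t + 1) - 1).
have -> : 1 + (t / (t + 1) - 1) = t / (t + 1) by rewrite addrC subrK.
rewrite ln_div ?posrE// => h.
have t1' : t + 1 != 0 by rewrite gt_eqF.
have E : t / (t + 1) - 1 = - (t + 1)^-1 by field.
rewrite E in h; rewrite -lerN2 opprB; apply: h.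
by rewrite ltrN2 invf_lt1// ltrDr.
Qed.

Hypothesis e_small : forall d, 0 < d -> exists X, forall x, X <= x ->
  mass x * ln x <= d * x.

(** For large n, the window [e^n, e^(n+1)] contributes at most mass(e^(n+1)) / e^n <= d / (n + 1) <=
    d (ln (n + 1) - ln n), which telescopes. *)
Lemma dil_inv1_le d : 0 < d -> exists2 C, 0 <= C & forall t, 1 <= t ->
  (dil e (fun u => (win 1 (expR t) inv1 u)%:E) 1 <= (C + d * ln t)%:E)%E.
Proof.
move=> d0.
(* Dividing d by e makes up for the ratio of the endpoints of a window. *)
have [X hX] := e_small (divr_gt0 d0 (expR_gt0 1)).
pose n0 := (Num.bound `|X|).+1.
have n01 : 1 <= n0%:R :> R by rewrite ler1n.
have hn0 t : n0%:R <= t -> X <= expR t.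
  move=> nt; apply: le_trans (expR_ge1Dx t); apply: le_trans (ler_norm _) _.
  apply: le_trans (ltW (archi_boundP (normr_ge0 X))) _.
  apply: le_trans (le_trans _ nt) _; first by rewrite ler_nat.
  by rewrite lerDr.
have main k : (dil e (fun u => (win 1 (expR (n0 + k)%:R) inv1 u)%:E) 1 <=
    (mass (expR n0%:R) + d * ln (n0 + k)%:R)%:E)%E.
  elim: k => [|k IH].
    rewrite addn0; apply: (le_trans (dil_win_le measurable_inv1 inv1_ge0 ler01 _)).
      by move=> u u1 _ _; rewrite inv1E// invf_le1// (lt_le_trans _ u1).
    by rewrite mul1r lee_fin lerDl mulr_ge0 ?(ltW d0)// ln_ge0.
  apply: (le_trans (dil_win_split _ (expR (n0 + k)%:R) _ measurable_inv1 inv1_ge0)).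
  set n := (n0 + k)%N in IH *; rewrite addnS -/n.
  have n_ge1 : 1 <= n%:R :> R by rewrite (le_trans n01)// ler_nat leq_addr.
  have n_gt0 : 0 < n%:R :> R by exact: lt_le_trans n_ge1.
  have N0 : 0 <= (expR n%:R)^-1 :> R by rewrite invr_ge0 expR_ge0.
  have l2 := @dil_win_le (expR n%:R) (expR n.+1%:R) _ _ measurable_inv1 inv1_ge0 N0.
  apply: le_trans (leeD IH (l2 _)) _.
    by move=> u u1 nu _; rewrite inv1E// lef_pV2// posrE ?expR_gt0// (lt_le_trans _ u1).
  rewrite -EFinD lee_fin -addrA lerD2l.
  have := hX (expR n.+1%:R); rewrite expRK => /(_ _)h.
  have {}h : mass (expR n.+1%:R) * n.+1%:R <= d / expR 1 * expR n.+1%:R.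
    by apply: h; apply: hn0; rewrite ler_nat ltnW// ltnS leq_addr.
  have {}h : (expR n%:R)^-1 * mass (expR n.+1%:R) <= d * (n%:R + 1)^-1.
    rewrite ler_pdivlMr ?addr_gt0// natr1 -mulrA mulrC ler_pdivrMr ?expR_gt0//.
    apply: le_trans h _; rewrite -[in leLHS]natr1 expRD.
    by rewrite (mulrC (expR _)) mulrA divfK// gt_eqF// expR_gt0.
  rewrite -lerBrDl -mulrBr; apply: le_trans h _.
  by rewrite ler_wpM2l ?(ltW d0)// -natr1; exact: ln_ge.
(* The first integer endpoint used beyond t is at most (n0 + 2) t, whose logarithm is ln (n0 + 2) +
   ln t. *)
exists (mass (expR n0%:R) + d * ln (n0.+2)%:R) => [|t t1].
  by rewrite addr_ge0 ?mass_ge0// mulr_ge0 ?(ltW d0)// ln_ge0// ler1n.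
have t0 : 0 < t by exact: lt_le_trans t1.
have /andP[k1 k2] := trunc_itv (ltW t0).
have le1 : t <= (n0 + (Num.trunc t).+1)%:R.
  by apply: le_trans (ltW k2) _; rewrite ler_nat leq_addl.
have le2 : (n0 + (Num.trunc t).+1)%:R <= n0.+2%:R * t.
  rewrite -[n0.+2]addn2 !natrD mulrDl lerD ?ler_peMr ?ler0n//.
  by rewrite -natr1 mulr_natl mulr2n lerD.
apply: le_trans (le_trans (main (Num.trunc t).+1) _).
  apply: le_dil => //; [exact: nnm_win measurable_inv1 inv1_ge0..|].
  move=> u u1; rewrite lee_fin /win u1/=; case: ifP => ut.
    by rewrite (le_trans ut)// ler_expR.
  by case: ifP => // _; exact: inv1_ge0.
rewrite lee_fin -addrA lerD2l -mulrDr ler_wpM2l ?(ltW d0)//.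
rewrite -lnM ?posrE// ler_ln// posrE; last by rewrite mulr_gt0.
exact: lt_le_trans le1.
Qed.

(** The smallness hypothesis with d = 1 covers large x; below the threshold both factors are
    monotone, so their product is at most its value there. *)
Lemma mass_lnp_le : exists2 C, 0 <= C & forall x, mass x * lnp x <= C * Num.max 1 x.
Proof.
have [X hX] := e_small ltr01; pose Y := Num.max 1 X.
exists (1 + mass Y * lnp Y) => [|x].
  by rewrite addr_ge0// mulr_ge0 ?mass_ge0 ?lnp_ge0.
have m1 : 1 <= Num.max 1 x by rewrite le_max lexx.
have p0 : 0 <= mass Y * lnp Y by rewrite mulr_ge0 ?mass_ge0 ?lnp_ge0.
have [Yx|xY] := leP Y x.
  have [x1 Xx] : 1 <= x /\ X <= x by move: Yx; rewrite ge_max => /andP[].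
  have := hX _ Xx; rewrite /lnp max_r// mul1r => h.
  by apply: le_trans h _; rewrite ler_peMl ?lerDl// (le_trans _ x1).
apply: (@le_trans _ _ (mass Y * lnp Y)).
  rewrite ler_pM ?mass_ge0 ?lnp_ge0 ?le_mass ?(ltW xY)//.
  rewrite ler_ln ?posrE ?lt_max ?ltr01//.
  by rewrite ge_max; apply/andP; split; rewrite le_max ?lexx// (ltW xY) orbT.
by apply: le_trans (ler_peMr _ m1); rewrite ?lerDr ?addr_ge0.
Qed.

Definition lninv u := lnp u * inv1 u.

Lemma lninv_ge0 u : 0 <= lninv u.
Proof. by rewrite mulr_ge0 ?lnp_ge0 ?inv1_ge0. Qed.

Lemma measurable_lninv : measurable_fun [set: R] lninv.
Proof. by apply: measurable_funM; [exact: measurable_lnp|exact: measurable_inv1]. Qed.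

(** A window whose endpoints have ratio at most e contributes at most (log b / a) mass(b) = O(b / a)
    = O(1), and at most 1 + l such windows cover [a, b]. *)
Lemma dil_lninv_le : exists2 C, 0 <= C & forall a b l, 1 <= a -> 0 <= l ->
  b <= a * expR l ->
  (dil e (fun u => (win a b lninv u)%:E) 1 <= (C * (1 + l))%:E)%E.
Proof.
have [C C0 hC] := mass_lnp_le; pose C1 := C * expR 1.
have C10 : 0 <= C1 by rewrite mulr_ge0 ?expR_ge0.
have base a b : 1 <= a -> b <= a * expR 1 ->
    (dil e (fun u => (win a b lninv u)%:E) 1 <= C1%:E)%E.
  move=> a1 ba; have a0 : 0 < a by exact: lt_le_trans a1.
  have c0 : 0 <= lnp b / a by rewrite divr_ge0 ?lnp_ge0 ?ltW.
  apply: (le_trans (dil_win_le measurable_lninv lninv_ge0 c0 _)).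
    move=> u u1 au ub; rewrite /lninv inv1E//.
    have u0 : 0 < u by exact: lt_le_trans u1.
    rewrite ler_pM ?lnp_ge0 ?invr_ge0 ?(ltW u0)//.
      by rewrite /lnp !max_r// ?ler_ln ?posrE// (le_trans u1, lt_le_trans u0).
    by rewrite lef_pV2 ?posrE.
  rewrite lee_fin mulrAC ler_pdivrMr// mulrC.
  apply: le_trans (hC b) _; rewrite /C1 -mulrA ler_wpM2l// mulrC ge_max ba andbT.
  by rewrite mulr_ege1// -[leLHS]expR0 ler_expR.
have main n a b : 1 <= a -> b <= a * expR n.+1%:R ->
    (dil e (fun u => (win a b lninv u)%:E) 1 <= (n.+1%:R * C1)%:E)%E.
  elim: n a => [|n IH] a a1 ba; first by rewrite mul1r; exact: base.
  apply: (le_trans (dil_win_split _ (a * expR 1) _ measurable_lninv lninv_ge0)).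
  rewrite -[n.+2]add1n natrD mulrDl mul1r EFinD; apply: leeD; first exact: base.
  apply: IH; last by rewrite -mulrA -expRD nat1r.
  by rewrite mulr_ege1// -[leLHS]expR0 ler_expR.
exists C1 => // a b l a1 l0 ba.
have /andP[k1 k2] := trunc_itv l0.
apply: (le_trans (main (Num.trunc l) a b a1 _)).
  by apply: le_trans ba _; rewrite ler_wpM2l ?ler_expR ?(ltW k2)// (le_trans _ a1).
by rewrite lee_fin mulrC ler_wpM2l// -natr1 addrC lerD2l.
Qed.

End windows.

Lemma half_le_onemhalf (R : realFieldType) (a : R) : a <= 1 -> 2^-1 <= 1 - a / 2.
Proof. lra. Qed.

(** * Decay of J(y), the mean of b(y / u) / u against exp*(|dE|) *)

Section mean_decay.
Context {R : realType}.
Variable A : smeasure R.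
Let e := sabs A.
Let F := sabs (sexp A).
Implicit Types (t y z u : R).

Let nnm_win1 y : nnm (fun u => (win 1 y inv1 u)%:E).
Proof. by apply: nnm_win; [exact: measurable_inv1|exact: inv1_ge0]. Qed.

(** The function 1/u cut off to [1, y] is submultiplicative on [1, +oo[, since x u <= y forces x <=
    y and u <= y. Hence [dil_exp_le] applies with K, and the function equals 1 at 1. *)
Lemma dil_exp_inv1_le y (K : R) : 1 <= y -> 0 <= K ->
  (dil e (fun u => (win 1 y inv1 u)%:E) 1 <= K%:E)%E ->
  (dil F (fun u => (win 1 y inv1 u)%:E) 1 <= (expR K)%:E)%E.
Proof.
move=> y1 K0 hK.
have := @dil_exp_le _ A _ _ K0 (nnm_win1 y) _ 1 (lexx 1).
have -> : win 1 y inv1 1 = 1 :> R by rewrite /win lexx y1/= inv1E// invr1.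
rewrite mulr1; apply=> x x1.
have c0 : (0 <= (win 1 y inv1 x)%:E)%E by case: (nnm_win1 y).
have -> : dil (sabs A) (fun u => (win 1 y inv1 u)%:E) x =
    dil (sabs A) (fun u => (win 1 y inv1 (x * u))%:E) 1.
  by rewrite /dil; under [RHS]eq_integral do rewrite mul1r.
apply: (@le_trans _ _ (dil (sabs A) (fun u => (win 1 y inv1 x)%:E *
    (win 1 y inv1 u)%:E) 1)%E); last first.
  by rewrite dilZ// muleC EFinM lee_wpmul2r.
apply: le_dil => //.
- exact: (nnm_mulr x (nnm_win1 y)).
- exact: nnmZ.
move=> u u1; rewrite -EFinM lee_fin /win u1 x1 mulr_ege1//=.
have x0 : 0 < x by exact: lt_le_trans x1.
have u0 : 0 < u by exact: lt_le_trans u1.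
case: ifP => [xuy|_]; last by rewrite mulr_ge0//; case: ifP => // _; exact: inv1_ge0.
rewrite (le_trans _ xuy) ?ler_peMr ?(ltW x0)//.
rewrite (le_trans _ xuy) ?ler_peMl ?(ltW u0)//.
by rewrite !inv1E ?mulr_ege1// invfM.
Qed.

(** A crude bound from 1/u <= 1, uniform on bounded ranges; it controls J(y) where the decay
    estimate does not reach. *)
Lemma dil_exp_inv1_fin y : exists C : R, forall z, z <= y ->
  (dil F (fun u => (win 1 z inv1 u)%:E) 1 <= C%:E)%E.
Proof.
pose Y := Num.max 1 y.
exists (expR (mass e Y)) => z zy.
have Y1 : 1 <= Y by rewrite le_max lexx.
apply: le_trans (dil_exp_inv1_le Y1 (mass_ge0 e Y) _); last first.
- rewrite -[mass e Y]mul1r; apply: dil_win_le => //.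
  + exact: measurable_inv1.
  + exact: inv1_ge0.
  + by move=> u u1 _ _; rewrite inv1E// invf_le1// (lt_le_trans _ u1).
apply: le_dil => // u u1; rewrite lee_fin /win u1/=; case: ifP => uz.
  by rewrite le_max (le_trans uz zy) orbT.
by case: ifP => // _; exact: inv1_ge0.
Qed.

Hypothesis e_small : forall d, 0 < d -> exists X, forall x, X <= x ->
  mass e x * ln x <= d * x.

Lemma dil_exp_inv1_powR (d : R) : 0 < d -> exists2 C, 0 <= C & forall t, 1 <= t ->
  (dil F (fun u => (win 1 (expR t) inv1 u)%:E) 1 <= (C * t `^ d)%:E)%E.
Proof.
move=> d0; have [C C0 hC] := dil_inv1_le e_small d0.
exists (expR C) => [|t t1]; first exact: expR_ge0.
have t0 : 0 < t by exact: lt_le_trans t1.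
rewrite /powR gt_eqF// -expRD; apply: dil_exp_inv1_le; last exact: hC.
- by rewrite -[leLHS]expR0 ler_expR ltW.
- by rewrite addr_ge0// mulr_ge0 ?(ltW d0)// ln_ge0.
Qed.

Variables (b : R -> R) (a C0 : R).
Hypotheses (mb : measurable_fun [set: R] b) (b0 : forall z, 0 <= b z).
Hypotheses (b1 : forall z, z < 1 -> b z = 0) (bC : forall z, b z <= C0).
Hypotheses (a0 : 0 < a) (a1 : a <= 1).
Hypothesis ba : forall z, 1 <= z -> b z * (ln z) `^ a <= C0.

Let C00 : 0 <= C0. Proof. exact: le_trans (b0 0) (bC 0). Qed.

Let measurable_bdiv z : measurable_fun [set: R] (fun u => b (z / u)).
Proof. exact: (measurableT_comp mb (measurable_divr z)). Qed.

(** The bound is uniform in z <= exp t, so that it can be applied with z = y / v for every v >= 1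
    when y = exp t. *)
Lemma dil_lninv_b_le : exists2 C, 0 <= C & forall t z, 1 <= t -> z <= expR t ->
  (dil e (fun u => (lninv u * b (z / u))%:E) 1 <= (C * t `^ (1 - a / 2))%:E)%E.
Proof.
have [C Cge0 hC] := dil_lninv_le e_small.
(* Four terms occur at the end: 1, T, T^(-a) and T^(-a) t, each at most t^(1 - a/2). *)
exists (4 * (C0 * C)) => [|t z t1 zt]; first by rewrite !mulr_ge0.
have t0 : 0 < t by exact: lt_le_trans t1.
pose T := t `^ 2^-1.
have T0 : 0 < T by exact: powR_gt0.
(* For 1 <= u < [al], log (z / u) >= T and the decay of b yields T^(-a). From [al] to z, a window of
   logarithmic length at most T, the constant C0 serves. *)
pose al := Num.max 1 (z * expR (- T)).
have al1 : 1 <= al by rewrite le_max lexx.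
have Ta0 : 0 <= T `^ (- a) by exact: powR_ge0.
have nw x y : nnm (fun u => (win x y (@lninv R) u)%:E).
  by apply: nnm_win; [exact: measurable_lninv|exact: lninv_ge0].
apply: (@le_trans _ _ (dil e (fun u => C0%:E * (win al z (@lninv R) u)%:E +
   (C0 * T `^ (- a))%:E * (win 1 z (@lninv R) u)%:E) 1)%E).
  apply: le_dil => //.
  - apply: nnmE; last by move=> u; rewrite mulr_ge0 ?lninv_ge0.
    by apply: measurable_funM => //; exact: measurable_lninv.
  - by apply: nnmD; apply: nnmZ => //; rewrite lee_fin ?mulr_ge0.
  move=> u u1; rewrite -!EFinM -EFinD lee_fin /win u1 /=.
  have u0 : 0 < u by exact: lt_le_trans u1.
  have l0 := @lninv_ge0 R u.
  have [uz|zu] := leP u z; last first.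
    by rewrite b1 ?ltr_pdivrMr ?mul1r// !andbF !mulr0 addr0.
  rewrite andbT; have [alu|ual] := leP al u.
    rewrite mulrC; apply: ler_wpDr; first by apply: mulr_ge0 => //; exact: mulr_ge0.
    by rewrite ler_wpM2r.
  rewrite mulr0 add0r mulrC ler_wpM2r//.
  have zu : u < z * expR (- T).
    by move: ual; rewrite lt_max ltNge u1.
  have z0 : 0 < z by exact: lt_le_trans uz.
  have lnT : T <= ln (z / u).
    rewrite -ler_expR lnK ?posrE ?divr_gt0// ler_pdivlMr// mulrC.
    by move: zu; rewrite expRN ltr_pdivlMr ?expR_gt0// => /ltW.
  rewrite powRN ler_pdivlMr ?powR_gt0//.
  have zu1 : 1 <= z / u by rewrite ler_pdivlMr// mul1r.
  apply: le_trans (ba zu1).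
  rewrite ler_wpM2l// ge0_ler_powR// ?nnegrE ?(ltW a0) ?(ltW T0)//.
  exact: le_trans (ltW T0) lnT.
rewrite dilD; last 2 first.
- by apply: nnmZ.
- by apply: nnmZ => //; rewrite lee_fin mulr_ge0.
rewrite !dilZ ?lee_fin ?mulr_ge0//.
apply: (@le_trans _ _ (C0%:E * (C * (1 + T))%:E +
    (C0 * T `^ (- a))%:E * (C * (1 + t))%:E)%E).
  apply: leeD; apply: lee_wpmul2l; rewrite ?lee_fin ?mulr_ge0//.
    apply: hC => //; first exact: ltW.
    rewrite /al maxr_pMl ?expR_ge0// le_max -mulrA -expRD addNr expR0 mulr1 lexx.
    by rewrite orbT.
  by apply: hC => //; [exact: ltW|rewrite mul1r].
rewrite -!EFinM -EFinD lee_fin.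
have T1 : T <= t `^ (1 - a / 2).
  exact: ler_powR (half_le_onemhalf a1).
have one : 1 <= t `^ (1 - a / 2).
  rewrite -[leLHS](powRr0 t); apply: ler_powR => //.
  by apply: le_trans (half_le_onemhalf a1); rewrite invr_ge0.
have Tt : T `^ (- a) * t = t `^ (1 - a / 2).
  rewrite /T -powRrM -[X in _ * X = _](powRr1 (ltW t0)) -powRD; last first.
    by apply/implyP => _; rewrite gt_eqF.
  by congr (_ `^ _); ring.
have Tle1 : T `^ (- a) <= T `^ (- a) * t by rewrite ler_peMr.
rewrite Tt in Tle1; set q := t `^ (1 - a / 2) in T1 one Tt Tle1 *.
have -> : C0 * (C * (1 + T)) + C0 * T `^ (- a) * (C * (1 + t)) =
  (C0 * C) * (1 + T + T `^ (- a) + T `^ (- a) * t) by ring.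
rewrite Tt (_ : 4 * (C0 * C) * q = C0 * C * (q + q + q + q)); last by ring.
by rewrite ler_wpM2l ?mulr_ge0// !lerD.
Qed.

Let w y u := b (y / u) * inv1 u.

Let nnm_w y : nnm (fun u => (w y u)%:E).
Proof.
apply: nnmE; last by move=> u; rewrite mulr_ge0 ?inv1_ge0.
by apply: measurable_funM => //; exact: measurable_inv1.
Qed.

Lemma dil_exp_b_le y : (dil F (fun u => (w y u)%:E) 1 <=
  C0%:E * dil F (fun u => (win 1 y inv1 u)%:E) 1)%E.
Proof.
rewrite -dilZ//; apply: le_dil => //; first exact: nnmZ.
move=> u u1; rewrite -EFinM lee_fin /win u1 /w /=.
have u0 : 0 < u by exact: lt_le_trans u1.
have [uy|yu] := leP u y; first by rewrite ler_wpM2r ?inv1_ge0.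
by rewrite b1 ?mul0r ?mulr0// ltr_pdivrMr// mul1r.
Qed.

Lemma dil_exp_b_decay : exists C, forall t, 1 <= t ->
  (dil F (fun u => (w (expR t) u)%:E) 1 <= (C * t `^ (- (a / 4)))%:E)%E.
Proof.
have [CB CB0 hB] := dil_lninv_b_le.
(* With H(y) = O(t^(a/4)), half of the gain t^(-a/2) of the inner integral survives. *)
have a40 : 0 < a / 4 by rewrite divr_gt0.
have [CH CH0 hH] := dil_exp_inv1_powR a40.
exists ((CB + C0) * CH) => t t1.
have t0 : 0 < t by exact: lt_le_trans t1.
set y := expR t; have y0 : 0 < y by exact: expR_gt0.
set H := dil F (fun u => (win 1 y inv1 u)%:E) 1.
have nl := @nnm_lnp R.
pose l u := lnp (y / u) * w y u.
have nnl : nnm (fun u => (l u)%:E).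
  apply: nnmE; last by move=> u; rewrite mulr_ge0 ?lnp_ge0 ?mulr_ge0 ?inv1_ge0.
  apply: measurable_funM.
    by apply: (measurableT_comp (@measurable_lnp R)); exact: measurable_divr.
  by apply: measurable_funM => //; exact: measurable_inv1.
have nlw : nnm (fun u => (lnp u)%:E * (w y u)%:E)%E by exact: nnmM.
(* t = log u + log (y / u) for 1 <= u <= y, and [w y] vanishes for u > y. *)
have step1 : (t%:E * dil F (fun u => (w y u)%:E) 1 <=
   dil F (fun u => (lnp u)%:E * (w y u)%:E) 1 + dil F (fun u => (l u)%:E) 1)%E.
  rewrite -dilZ ?lee_fin ?(ltW t0)// -dilD//.
  apply: le_dil => //; [by apply: nnmZ; rewrite ?lee_fin ?(ltW t0)|exact: nnmD|].
  move=> u u1; rewrite -!EFinM -EFinD lee_fin /l -mulrDl.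
  have u0 : 0 < u by exact: lt_le_trans u1.
  have [uy|yu] := leP u y; last first.
    by rewrite /w b1 ?mul0r ?mulr0// ltr_pdivrMr// mul1r.
  rewrite ler_wpM2r ?mulr_ge0 ?inv1_ge0// -lnpM//; last by rewrite ler_pdivlMr// mul1r.
  rewrite mulrCA divff ?gt_eqF// mulr1 /lnp max_r; first by rewrite /y expRK.
  by rewrite -[leLHS]expR0 ler_expR ltW.
(* The Leibniz inequality moves log onto [e]; the inner integral at v is at most 1/v times that of
   [dil_lninv_b_le] at z = y / v, and vanishes for v > y. *)
have step2 : (dil F (fun u => (lnp u)%:E * (w y u)%:E) 1 <=
    (CB * t `^ (1 - a / 2))%:E * H)%E.
  apply: (le_trans (dil_exp_lnp_le A (nnm_w y))).
  rewrite -dilZ ?lee_fin ?mulr_ge0 ?powR_ge0//.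
  apply: le_dil => //; first exact: nnm_ldil.
    by apply: nnmZ => //; rewrite lee_fin mulr_ge0 ?powR_ge0.
  move=> v v1; have v0 : 0 < v by exact: lt_le_trans v1.
  have iv0 : (0 <= (inv1 v)%:E)%E by rewrite lee_fin inv1_ge0.
  have nB : nnm (fun u => (lninv u * b (y / v / u))%:E).
    apply: nnmE; last by move=> u; rewrite mulr_ge0 ?lninv_ge0.
    by apply: measurable_funM => //; exact: measurable_lninv.
  have win0 : (0 <= (win 1 y inv1 v)%:E)%E by case: (nnm_win1 y).
  have ldilE : (ldil (sabs A) (fun u => (w y u)%:E) v <=
      (win 1 y inv1 v)%:E * dil e (fun u => (lninv u * b (y / v / u))%:E) 1)%E.
    have -> : ldil (sabs A) (fun u => (w y u)%:E) v =
        dil e (fun u => (lnp u)%:E * (w y (v * u))%:E)%E 1.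
      by rewrite /dil /ldil; under [RHS]eq_integral do rewrite mul1r.
    rewrite -dilZ//; apply: le_dil => //.
    - by apply: nnmM => //; exact: (nnm_mulr v (nnm_w y)).
    - exact: nnmZ.
    move=> u u1; rewrite -!EFinM lee_fin /win v1 /w/=.
    have u0 : 0 < u by exact: lt_le_trans u1.
    have [vy|yv] := leP v y.
      have -> : y / (v * u) = y / v / u by rewrite invfM mulrA.
      rewrite /lninv !inv1E ?mulr_ege1// invfM le_eqVlt; apply/orP; left.
      by apply/eqP; ring.
    rewrite b1 ?mul0r ?mulr0// ltr_pdivrMr ?mulr_gt0// mul1r.
    by apply: lt_le_trans yv _; rewrite ler_peMr ?(ltW v0).
  apply: (le_trans ldilE); rewrite muleC lee_wpmul2r//.
  by apply: hB => //; rewrite ler_pdivrMr// ler_peMr// ltW.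
(* With s = log (y / u) <= t, s b(y / u) = s^(1 - a) (s^a b(y / u)) <= t^(1 - a) C0, as a <= 1. *)
have step3 : (dil F (fun u => (l u)%:E) 1 <= (C0 * t `^ (1 - a))%:E * H)%E.
  have k0 : (0 <= (C0 * t `^ (1 - a))%:E)%E by rewrite lee_fin mulr_ge0 ?powR_ge0.
  rewrite -dilZ//; apply: le_dil => //; first exact: nnmZ.
  move=> u u1; rewrite -!EFinM lee_fin /l /win u1 /=.
  have u0 : 0 < u by exact: lt_le_trans u1.
  have [uy|yu] := leP u y; last first.
    by rewrite /w b1 ?mul0r ?mulr0// ltr_pdivrMr// mul1r.
  rewrite /w mulrA ler_wpM2r ?inv1_ge0//.
  have yu1 : 1 <= y / u by rewrite ler_pdivlMr// mul1r.
  rewrite /lnp max_r//; have s0 : 0 <= ln (y / u) by exact: ln_ge0.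
  have st : ln (y / u) <= t.
    by rewrite ln_div ?posrE// /y expRK lerBlDr lerDl ln_ge0.
  have [->|sN0] := eqVneq (ln (y / u)) 0; first by rewrite mul0r mulr_ge0 ?powR_ge0.
  rewrite -[X in X * _](powRr1 s0) -[X in _ `^ X](subrK a) powRD; last first.
    by apply/implyP.
  rewrite -mulrA mulrC ler_pM ?mulr_ge0 ?powR_ge0//.
    by rewrite mulrC ba.
  by rewrite ge0_ler_powR// ?nnegrE ?subr_ge0// ltW.
have q0 : 0 <= CB * t `^ (1 - a / 2) + C0 * t `^ (1 - a).
  by rewrite addr_ge0// mulr_ge0 ?powR_ge0.
have : (t%:E * dil F (fun u => (w y u)%:E) 1 <=
    ((CB * t `^ (1 - a / 2) + C0 * t `^ (1 - a)) * (CH * t `^ (a / 4)))%:E)%E.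
  apply: (le_trans step1); apply: (le_trans (leeD step2 step3)).
  rewrite -ge0_muleDl ?lee_fin ?mulr_ge0 ?powR_ge0// -EFinD [leRHS]EFinM.
  by rewrite lee_wpmul2l ?lee_fin//; exact: hH.
rewrite -lee_pdivlMl// => /le_trans; apply; rewrite -EFinM lee_fin.
have -> : (CB + C0) * CH * t `^ (- (a / 4)) =
   t^-1 * (((CB + C0) * t `^ (1 - a / 2)) * (CH * t `^ (a / 4))).
  have -> : t `^ (- (a / 4)) = t^-1 * t `^ (1 - a / 2) * t `^ (a / 4).
    rewrite -{2}(powRr1 (ltW t0)) -powRN -!powRD; last 2 first.
    - by apply/implyP => _; rewrite gt_eqF.
    - by apply/implyP => _; rewrite gt_eqF.
    by congr (_ `^ _); field.
  by ring.
rewrite ler_pM2l ?invr_gt0// ler_wpM2r ?mulr_ge0 ?powR_ge0// mulrDl lerD2l.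
rewrite ler_wpM2l// ler_powR// lerD2l lerN2 ler_pdivrMr//.
by rewrite ler_peMr ?ler1n// ltW.
Qed.

End mean_decay.

(** * Averaging over exp*(|dR|) *)

Section remainder.
Context {R : realType}.

Let nnm_inv1 : nnm (fun u : R => (inv1 u)%:E).
Proof. by apply: nnmE; [exact: measurable_inv1|exact: inv1_ge0]. Qed.

Definition inv1_tail (N u : R) : R := if N < u then inv1 u else 0.

Lemma nnm_inv1_tail (N : R) : nnm (fun u => (inv1_tail N u)%:E).
Proof.
apply: nnmE; last by move=> u; rewrite /inv1_tail; case: ifP => // _; exact: inv1_ge0.
apply: measurable_fun_ifT => //; last exact: measurable_inv1.
exact: measurable_fun_ltr.
Qed.

Lemma inv1M (x u : R) : 1 <= x -> 1 <= u -> inv1 (x * u) = inv1 x * inv1 u.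
Proof. by move=> x1 u1; rewrite !inv1E ?mulr_ege1// invfM. Qed.

(** As 1/u is multiplicative on [1, +oo[, it is an eigenfunction there, with the integral of 1/u as
    eigenvalue; [dil_exp_le] exponentiates it. *)
Lemma dil_exp_inv1_total (A : smeasure R) :
  (dil (sabs A) (fun u => (inv1 u)%:E) 1 < +oo ->
   dil (sabs (sexp A)) (fun u => (inv1 u)%:E) 1 < +oo)%E.
Proof.
move=> fin; set I := dil _ _ _ in fin.
have I0 : (0 <= I)%E by exact: dil_ge0.
have IE : I = (fine I)%:E by rewrite fineK// ge0_fin_numE.
apply: le_lt_trans (ltry (expR (fine I) * inv1 1)).
apply: dil_exp_le => //; first exact: fine_ge0.
move=> x x1; rewrite mulrC EFinM -IE -dilZ ?lee_fin ?inv1_ge0//.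
rewrite [leLHS](_ : _ = dil (sabs A) (fun u => (inv1 (x * u))%:E) 1); last first.
  by rewrite /dil; under [RHS]eq_integral do rewrite mul1r.
apply: le_dil => //; first exact: (nnm_mulr x nnm_inv1).
  by apply: nnmZ; rewrite ?lee_fin ?inv1_ge0.
by move=> u u1; rewrite -EFinM inv1M.
Qed.

Lemma dil_inv1_tail_le (G : lfmeasure R) (d : R) :
  (dil G (fun u => (inv1 u)%:E) 1 < +oo)%E -> 0 < d ->
  exists N, (dil G (fun u => (inv1_tail N u)%:E) 1 <= d%:E)%E.
Proof.
move=> fin d0.
have [mi i0] := nnm_mulr 1 nnm_inv1.
have mt (n : nat) := (nnm_mulr 1 (nnm_inv1_tail n%:R)).
have igr : (lfm_sf G).-integrable [set: R] (fun u => (inv1 (1 * u))%:E).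
  apply/integrableP; split => //.
  by under eq_integral do rewrite gee0_abs ?lee_fin ?inv1_ge0//.
have cv : (\int[lfm_sf G]_u (inv1_tail n%:R (1 * u))%:E @[n --> \oo] -->
    \int[lfm_sf G]_u (cst 0 u))%E.
  apply: (@dominated_cvg _ _ _ (lfm_sf G) _ measurableT
     (fun n u => (inv1_tail n%:R (1 * u))%:E) _ (fun u => (inv1 (1 * u))%:E)) => //.
  - by move=> n; case: (mt n).
  - move=> u _; apply: cvg_near_cst.
    exists (Num.bound `|u|) => // n /= un; rewrite /inv1_tail mul1r ltNge.
    rewrite (le_trans (ler_norm u))// (le_trans (ltW (archi_boundP (normr_ge0 u))))//.
    by rewrite ler_nat.
  - move=> n u _; rewrite abse_EFin lee_fin /inv1_tail.
    by case: ifP => _; rewrite ?normr0 ?inv1_ge0// ger0_norm ?inv1_ge0.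
rewrite [X in _ --> X]integral0 in cv.
have [fn /cvgr0_norm_le cn] := (fine_cvgP _ _).1 cv.
have [N _ hN] := filterI fn (cn _ d0).
have /= [fN le] := hN N (leqnn N).
exists N%:R; rewrite /dil -(fineK fN) lee_fin.
exact: le_trans (ler_norm _) le.
Qed.

Lemma lfm_integral_inv (m : lfmeasure R) :
  (\int[m]_(u in `[1%R, +oo[) (u^-1)%:E)%E = dil m (fun u => (inv1 u)%:E) 1.
Proof.
have [mi i0] := nnm_mulr 1 nnm_inv1.
have mN : measurable (`]-oo, 1%R[ : set R) by [].
have N0 : lfm_sf m `]-oo, 1%R[%classic = 0%E by exact: lfm_supp.
rewrite /dil (ge0_negligible_integral mN measurableT mi _ N0)//.
have -> : [set: R] `\` `]-oo, 1%R[ = `[1%R, +oo[%classic.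
  apply/seteqP; split=> u /=; rewrite !in_itv/= ?andbT; first by case=> _ /negP; rewrite -leNgt.
  by move=> u1; split => //; apply/negP; rewrite -leNgt.
apply: eq_integral => u; rewrite inE/= in_itv/= andbT => u1.
by rewrite mul1r inv1E.
Qed.

(* Splitting at v = x / Y: below, [J (x / v)] is small; above, the tail of [dG v / v] is. *)
Lemma dil_smallo (G : lfmeasure R) (J : R -> \bar R) (P : R -> R -> \bar R) (C1 : R) :
  (dil G (fun u => (inv1 u)%:E) 1 < +oo)%E ->
  0 <= C1 -> (forall y, J y <= C1%:E)%E ->
  (forall d, 0 < d -> exists Y, forall y, Y <= y -> (J y <= d%:E)%E) ->
  (forall x, nnm (P x)) ->
  (forall x v, 0 < x -> 1 <= v -> (P x v <= (x * inv1 v)%:E * J (x / v)%R)%E) ->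
  forall d, 0 < d -> exists X, forall x, X <= x -> (dil G (P x) 1 <= (d * x)%:E)%E.
Proof.
move=> fin C10 JC Jd nP PJ d d0; set I := dil _ _ _ in fin.
have I0 : (0 <= I)%E by exact: dil_ge0.
have IE : I = (fine I)%:E by rewrite fineK// ge0_fin_numE.
have fI0 : 0 <= fine I by exact: fine_ge0.
(* Each of the two ranges of v receives d / 2; dividing by 1 + c instead of c covers c = 0. *)
have small (c : R) : 0 <= c -> exists2 r, 0 < r & c * r <= d / 2.
  move=> c0; have c1 : 0 < 1 + c by rewrite ltr_pwDl.
  exists (d / 2 / (1 + c)); first by rewrite !divr_gt0.
  by rewrite mulrA ler_pdivrMr// mulrC ler_wpM2l ?divr_ge0 ?(ltW d0)// lerDr.
have [d1 d10 l1] := small _ fI0.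
have [d2 d20 l2] := small _ C10.
have [Y0 hY] := Jd _ d10; pose Y := Num.max 1 Y0.
have Y1 : 0 < Y by rewrite lt_max ltr01.
have [N hN] := dil_inv1_tail_le fin d20.
(* For x >= N Y, x / v < Y forces v > N, the range of the small tail. *)
exists (Num.max 1 (N * Y)) => x; rewrite ge_max => /andP[x1 xNY].
have x0 : 0 < x by exact: lt_le_trans x1.
apply: (@le_trans _ _ (dil G (fun v => (x * d1)%:E * (inv1 v)%:E +
    (x * C1)%:E * (inv1_tail N v)%:E) 1)%E).
  apply: le_dil => //.
    apply: nnmD; apply: nnmZ.
    - by rewrite lee_fin mulr_ge0 ?(ltW x0) ?(ltW d10).
    - exact: nnm_inv1.
    - by rewrite lee_fin mulr_ge0 ?(ltW x0).
    - exact: nnm_inv1_tail.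
  move=> v v1; have v0 : 0 < v by exact: lt_le_trans v1.
  have xi0 : (0 <= (x * inv1 v)%:E)%E by rewrite lee_fin mulr_ge0 ?(ltW x0) ?inv1_ge0.
  apply: (le_trans (PJ _ _ x0 v1)); rewrite -!EFinM -EFinD /inv1_tail.
  case: (leP Y (x / v)) => [Yxv|xvY].
    apply: (@le_trans _ _ ((x * inv1 v)%:E * d1%:E)%E).
      by rewrite lee_wpmul2l// hY// (le_trans _ Yxv)// le_max lexx orbT.
    rewrite -EFinM lee_fin mulrAC lerDl mulr_ge0 ?mulr_ge0 ?(ltW x0)//.
    by case: ifP => // _; exact: inv1_ge0.
  have Nv : N < v.
    rewrite -(ltr_pM2r Y1); apply: le_lt_trans xNY _.
    by move: xvY; rewrite ltr_pdivrMr// mulrC.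
  rewrite Nv; apply: (@le_trans _ _ ((x * inv1 v)%:E * C1%:E)%E).
    by rewrite lee_wpmul2l.
  rewrite -EFinM lee_fin mulrAC lerDr; apply: mulr_ge0; last exact: inv1_ge0.
  by apply: mulr_ge0; exact: ltW.
have k1 : (0 <= (x * d1)%:E)%E by rewrite lee_fin mulr_ge0 ?(ltW x0) ?(ltW d10).
have k2 : (0 <= (x * C1)%:E)%E by rewrite lee_fin mulr_ge0 ?(ltW x0).
rewrite dilD; [|exact: nnmZ|by apply: nnmZ => //; exact: nnm_inv1_tail].
rewrite (@dilZ _ _ _ _ _ k1 nnm_inv1) (@dilZ _ _ _ _ _ k2 (nnm_inv1_tail N)).
apply: (@le_trans _ _ ((x * d1)%:E * (fine I)%:E + (x * C1)%:E * d2%:E)%E).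
  by apply: leeD; [rewrite -IE|rewrite lee_wpmul2l// lee_fin mulr_ge0// ltW].
rewrite -!EFinM -EFinD lee_fin -!mulrA -mulrDr mulrC ler_wpM2r ?(ltW x0)// (mulrC d1).
by apply: le_trans (lerD l1 l2) _; rewrite -splitr.
Qed.

End remainder.

(** * From the Landau hypotheses to explicit inequalities *)

Section growth.
Context {R : realType}.
Implicit Type A : smeasure R.

Lemma primitive_lt1 A (z : R) : z < 1 -> primitive A z = 0.
Proof.
by move=> z1; rewrite /primitive /signed_val set_itv_ge ?bnd_simp -?ltNge// !measure0 subrr.
Qed.

Lemma normr_primitive_le A (z : R) : `|primitive A z| <= mass (sabs A) z.
Proof.
have fin l : (l : lfmeasure R) `[1%R, z]%classic \is a fin_num.
  by rewrite ge0_fin_numE// lfm_fin.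
rewrite /mass lfm_addE fineD//; apply: le_trans (ler_normB _ _) _.
by rewrite !ger0_norm ?fine_ge0.
Qed.

(** The hypothesis handles large z and the monotone total mass handles the rest. Capping the
    exponent at 1, as [dil_exp_b_decay] requires, only weakens the bound where ln z >= 1. *)
Lemma primitive_growth A (a : R) : 0 < a ->
  (fun x : R => primitive A x : R^o) =O_+oo (fun x : R => x / (ln x) `^ a : R^o) ->
  exists C0, (forall z, `|primitive A z| * inv1 z <= C0) /\
    (forall z, 1 <= z ->
      `|primitive A z| * inv1 z * (ln z) `^ (Num.min a 1) <= C0).
Proof.
move=> a0 /eqO_exP[k k0 [M [_ hM]]].
set a' := Num.min a 1.
have a'0 : 0 <= a' by rewrite le_min (ltW a0) ler01.
(* [expR 1] ensures ln z >= 1 from X on; [M + 1] meets the strict inequality in the neighbourhoods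
   of +oo. *)
pose X := Num.max (expR 1) (M + 1).
have X1 : 1 <= X by rewrite le_max -[leLHS]expR0 ler_expR ler01.
pose V := mass (sabs A) X.
have V0 : 0 <= V by exact: mass_ge0.
have p0 : 0 <= V * (ln X) `^ a' by rewrite mulr_ge0 ?powR_ge0.
have i1 z : inv1 z <= 1 :> R by rewrite invf_le1 ?lt_max ?ltr01// le_max lexx.
have small z : z <= X -> `|primitive A z| * inv1 z <= V.
  move=> zX; apply: (@le_trans _ _ (`|primitive A z|)).
    by rewrite ler_piMr.
  by apply: le_trans (normr_primitive_le A z) _; exact: le_mass.
have big z : X <= z -> 1 <= ln z /\ `|primitive A z| * inv1 z * (ln z) `^ a <= k.
  move=> Xz; have [ez Mz] : expR 1 <= z /\ M + 1 <= z.
    by move: Xz; rewrite ge_max => /andP[].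
  have z0 : 0 < z by exact: lt_le_trans (expR_gt0 1) ez.
  have z1 : 1 <= z by exact: le_trans Xz.
  have lz : 1 <= ln z by rewrite -ler_expR lnK.
  have lz0 : 0 < ln z `^ a by rewrite powR_gt0// (lt_le_trans _ lz).
  split => //; have /= := hM z (lt_le_trans (ltr_pwDr ltr01 (lexx M)) Mz).
  rewrite [X in _ * X]ger0_norm ?divr_ge0 ?(ltW z0) ?(ltW lz0)// => h.
  by rewrite inv1E// -ler_pdivlMr// ler_pdivrMr// mulrAC -mulrA.
exists (k + V + V * (ln X) `^ a'); split => [z|z z1].
  have [zX|/ltW /big[lz h]] := leP z X.
    by rewrite (le_trans (small z zX))// -addrA ler_wpDl ?(ltW k0)// lerDl.
  rewrite -!addrA; apply: ler_wpDr; first by rewrite addr_ge0.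
  by apply: le_trans h; rewrite ler_peMr ?mulr_ge0 ?inv1_ge0// -(powRr0 (ln z)) ler_powR// ltW.
have [zX|/ltW /big[lz h]] := leP z X.
  apply: ler_wpDl; first by rewrite addr_ge0// ltW.
  rewrite ler_pM ?powR_ge0 ?mulr_ge0 ?inv1_ge0 ?small// ge0_ler_powR// ?nnegrE ?ln_ge0//.
  by rewrite ler_ln ?posrE ?(lt_le_trans ltr01).
rewrite -!addrA; apply: ler_wpDr; first by rewrite addr_ge0.
apply: le_trans h; rewrite ler_wpM2l ?mulr_ge0 ?inv1_ge0//.
by rewrite ler_powR// ge_min lexx.
Qed.

Lemma svar_mass_smallo (E : smeasure R) (m : lfmeasure R) :
  (forall X, measurable X -> m X = svar E X) ->
  (fun x : R => fine (svar E `[1%R, x]%classic) : R^o)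
       =o_+oo (fun x : R => x / ln x : R^o) ->
  forall d, 0 < d -> exists X, forall x, X <= x -> mass m x * ln x <= d * x.
Proof.
move=> mE /eqoP h d d0; have [M [_ hM]] := h d d0.
exists (Num.max (expR 1) (M + 1)) => x; rewrite ge_max => /andP[ex Mx].
have x0 : 0 < x by exact: lt_le_trans (expR_gt0 1) ex.
have lx : 0 < ln x by rewrite (lt_le_trans ltr01)// -ler_expR lnK.
have /= := hM x (lt_le_trans (ltr_pwDr ltr01 (lexx M)) Mx).
rewrite [X in _ * X]ger0_norm ?divr_ge0 ?(ltW x0) ?(ltW lx)// ger0_norm ?fine_ge0//.
by rewrite mulrA ler_pdivlMr// /mass mE.
Qed.

End growth.

(** * Assembling the estimates into M(x) = o(x) *)

Lemma powR_decay (R : realType) (c C d : R) : 0 < c -> 0 < d ->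
  exists2 t0, 1 <= t0 & forall t, t0 <= t -> C * t `^ (- c) <= d.
Proof.
move=> c0 d0; pose q := 1 + `|C| / d.
have q1 : 1 <= q by rewrite lerDl divr_ge0 ?(ltW d0).
exists (q `^ c^-1) => [|t qt].
  by rewrite -(powRr0 q) ler_powR// invr_ge0 ltW.
have qc : q <= t `^ c.
  have -> : q = (q `^ c^-1) `^ c.
    by rewrite -powRrM mulVf ?gt_eqF// powRr1// (le_trans ler01).
  by rewrite ge0_ler_powR ?nnegrE ?(ltW c0) ?powR_ge0// (le_trans _ qt) ?powR_ge0.
have tc : 0 < t `^ c by exact: lt_le_trans (lt_le_trans ltr01 q1) qc.
rewrite powRN ler_pdivrMr//; apply: (le_trans (ler_norm C)).
apply: (@le_trans _ _ (d * q)); last by rewrite ler_wpM2l ?(ltW d0).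
by rewrite mulrDr mulr1 mulrCA divff ?gt_eqF// mulr1 lerDr ltW.
Qed.

Theorem theorem1p1 (R : realType) (Pi0 E Rem : smeasure R)
  (h1 : exists2 a : R, 0 < a &
     (fun x : R => primitive (sexp (sopp Pi0)) x : R^o)
       =O_+oo (fun x : R => x / (ln x) `^ a : R^o))
  (h2 : (fun x : R => fine (svar E `[1%R, x]%classic) : R^o)
       =o_+oo (fun x : R => x / ln x : R^o))
  (h3 : (\int[svar Rem]_(u in `[1%R, +oo[) (u^-1)%:E < +oo)%E) :
  (fun x : R => primitive (sexp (sopp (sadd (sadd Pi0 E) Rem))) x : R^o)
    =o_+oo (fun x : R => x : R^o).
Proof.
have [E' E'E EE'] := smeasure_jordan E.
have [R' R'E RR'] := smeasure_jordan Rem.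
set A0 := sopp Pi0; set A1 := sopp E'; set A2 := sopp R'.
have A1E X : measurable X -> sabs A1 X = svar E X.
  by move=> _; rewrite lfm_addE addeC E'E.
have A2E X : measurable X -> sabs A2 X = svar Rem X.
  by move=> _; rewrite lfm_addE addeC R'E.
(* The Jordan pairs replace E and Rem. With - Pi0 as last summand, [primitive_exp_le] integrates
   |M_0| against exp*(A2 + A1), which splits into the integrals over G and F. *)
have ME x : primitive (sexp (sopp (sadd (sadd Pi0 E) Rem))) x =
    primitive (sexp (sadd (sadd A2 A1) A0)) x.
  apply: primitive_sexp_seqv => X mX.
  change (lfm_add (lfm_add (sneg Pi0) (sneg E)) (sneg Rem) X +
      lfm_add (lfm_add (spos R') (spos E')) (spos Pi0) X =
    lfm_add (lfm_add (sneg R') (sneg E')) (sneg Pi0) X +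
      lfm_add (lfm_add (spos Pi0) (spos E)) (spos Rem) X)%E.
  rewrite !lfm_addE [LHS](AC (3*3) (1*6*(5*2)*(4*3))%AC) /=.
  by rewrite -(EE' _ mX) -(RR' _ mX) [RHS](AC (3*3) (3*4*(5*2)*(6*1))%AC).
have [a a0 /(primitive_growth a0)[C0 [bC ba]]] := h1.
pose b z := `|primitive (sexp A0) z| * inv1 z.
have b0 z : 0 <= b z by rewrite mulr_ge0 ?inv1_ge0.
have mb : measurable_fun [set: R] b.
  apply: measurable_funM; last exact: measurable_inv1.
  by apply: measurableT_comp => //; exact: measurable_primitive.
have b1 z : z < 1 -> b z = 0 by move=> z1; rewrite /b primitive_lt1// normr0 mul0r.
have a'0 : 0 < Num.min a 1 by rewrite lt_min a0 ltr01.
have a'1 : Num.min a 1 <= 1 by rewrite ge_min lexx orbT.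
have sm := svar_mass_smallo A1E h2.
have [CD hCD] := dil_exp_b_decay sm mb b0 b1 bC a'0 a'1 ba.
pose F := sabs (sexp A1); pose G := sabs (sexp A2).
pose w y u := b (y / u) * inv1 u.
have nw y : nnm (fun u => (w y u)%:E).
  apply: nnmE; last by move=> u; rewrite mulr_ge0 ?inv1_ge0.
  apply: measurable_funM; last exact: measurable_inv1.
  exact: (measurableT_comp mb (measurable_divr y)).
pose J y := dil F (fun u => (w y u)%:E) 1.
have Jd d : 0 < d -> exists Y, forall y, Y <= y -> (J y <= d%:E)%E.
  move=> d0; have c0 : 0 < Num.min a 1 / 4 by rewrite divr_gt0.
  have [t0 t01 ht] := powR_decay CD c0 d0.
  exists (expR t0) => y ty.
  have y0 : 0 < y by exact: lt_le_trans (expR_gt0 _) ty.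
  have lt : t0 <= ln y by rewrite -ler_expR lnK.
  rewrite -(lnK y0); apply: le_trans (hCD (ln y) (le_trans t01 lt)) _.
  by rewrite lee_fin ht.
(* Beyond Y the decay gives J <= 1; up to Y, J is at most C0 times the crude bound [CY]. *)
have [C1 C10 JC] : exists2 C1, 0 <= C1 & forall y, (J y <= C1%:E)%E.
  have [Y hY] := Jd 1 ltr01; have [CY hCY] := dil_exp_inv1_fin A1 Y.
  have C00 : 0 <= C0 by exact: le_trans (b0 0) (bC 0).
  exists (Num.max 1 (C0 * CY)); first by rewrite le_max ler01.
  move=> y; have [/hY|/ltW yY] := leP Y y.
    by move/le_trans; apply; rewrite lee_fin le_max lexx.
  apply: (le_trans (dil_exp_b_le A1 mb b0 b1 bC y)).
  apply: (@le_trans _ _ (C0%:E * CY%:E)%E).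
    by rewrite lee_wpmul2l ?lee_fin//; exact: hCY.
  by rewrite -EFinM lee_fin le_max lexx orbT.
pose m0 x u := (`|primitive (sexp A0) (x / u)|%:E)%E.
have nm0 x : nnm (m0 x).
  apply: nnmE => //; apply: measurableT_comp => //.
  by apply: (measurableT_comp (measurable_primitive _)); exact: measurable_divr.
pose P x := dil F (m0 x).
have Gfin : (dil G (fun u => (inv1 u)%:E) 1 < +oo)%E.
  apply: dil_exp_inv1_total; rewrite (eq_dil _ _ A2E).
  by rewrite -lfm_integral_inv.
(* [P x v] integrates |M_0(x / (v u))| over dF(u), and |M_0(z)| = z b(z) with z = x / (v u) gives
   the factor x / v; for z < 1 both integrands vanish. *)
have PJ x v : 0 < x -> 1 <= v -> (P x v <= (x * inv1 v)%:E * J (x / v)%R)%E.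
  move=> x0 v1; have v0 : 0 < v by exact: lt_le_trans v1.
  rewrite -dilZ//; last by rewrite lee_fin mulr_ge0 ?inv1_ge0 ?ltW.
  rewrite /P [leLHS](_ : _ = dil F (fun u => m0 x (v * u)) 1); last first.
    by rewrite /dil; under [RHS]eq_integral do rewrite mul1r.
  apply: le_dil => //; first exact: nnm_mulr.
    by apply: nnmZ => //; rewrite lee_fin mulr_ge0 ?inv1_ge0 ?ltW.
  move=> u u1; rewrite -EFinM lee_fin /w /b.
  have u0 : 0 < u by exact: lt_le_trans u1.
  have -> : x / (v * u) = x / v / u by rewrite invfM mulrA.
  have [z1|z1] := ltP (x / v / u) 1.
    by rewrite primitive_lt1// normr0 !(mul0r, mulr0).
  rewrite !inv1E// le_eqVlt; apply/orP; left; apply/eqP.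
  by field; rewrite !gt_eqF.
have nP x : nnm (P x) by exact: nnm_dil.
have main := dil_smallo Gfin C10 JC Jd nP PJ.
apply/eqoP => d d0; have [X hX] := main d d0.
exists (Num.max 0 X); split; first exact: num_real.
move=> x; rewrite gt_max => /andP[x0 /ltW Xx].
rewrite ME -lee_fin (ger0_norm (ltW x0)).
apply: le_trans (hX x Xx); apply: (le_trans (primitive_exp_le A0 (sadd A2 A1) x)).
by rewrite (dil_sabs_exp_add A2 A1 _ (nm0 x)) -/(P x) lexx.
Qed.
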